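(* Let $p\in[0,1]$, let $(B_t)_{t\ge 0}$ be a standard Brownian motion started at $B_0=p$, and let \[ \tau=\inf\{t\ge 0:\ B_t\notin(0,1)\} \] be its first exit time from $(0,1)$. Then \[ \inf_{A}\|S_2(\mathbbm{1}_A)\|_1=\mathbb{E}_p\sqrt{\tau}, \] where the infimum is taken over all Borel sets $A\subset[0,1)$ of Lebesgue measure $|A|=p$.
   Context: Work on the probability space $[0,1)$ with its Borel $\sigma$-algebra and Lebesgue measure; $|A|$ denotes Lebesgue measure and $\mathbbm{1}_A$ the indicator function of $A$. For $n\ge 0$ let $\mathcal{D}_n=\{[k/2^n,(k+1)/2^n): k=0,\dots,2^n-1\}$ be the dyadic intervals of level $n$ and let $\mathcal{F}_n$ be the (finite) $\sigma$-algebra generated by $\mathcal{D}_n$. For $f\in L^1([0,1))$ put $f_n=\mathbb{E}(f\mid\mathcal{F}_n)$ (so $f_n$ equals the average of $f$ over $I$ on each $I\in\mathcal{D}_n$), $d_n=f_n-f_{n-1}$ for $n\ge 1$, and define the dyadic square function \[ S_2(f)=\Big(\sum_{n\ge 1}|d_n|^2\Big)^{1/2}\in[0,\infty]. \] $\|g\|_1=\int_0^1|g|$. $\mathbb{E}_p$ denotes expectation for the Brownian motion started at $p$. *)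

(* Defs.v *)
From HB Require Import structures.
From mathcomp Require Import all_boot all_order all_algebra.
From mathcomp Require Import all_classical all_reals all_analysis.
Set Implicit Arguments.
Unset Strict Implicit.
Unset Printing Implicit Defensive.
Import Order.TTheory GRing.Theory Num.Theory.
Import numFieldTopology.Exports numFieldNormedType.Exports.
Local Open Scope classical_set_scope.
Local Open Scope ring_scope.

Section dyadic_square_function.
Context {R : realType}.
Local Notation mu := (@lebesgue_measure R).
Implicit Types (f : R -> R) (A : set R) (n k : nat) (x p : R).

Definition dyadic_interval n k : set R :=
  [set` `[k%:R / 2 ^+ n, k.+1%:R / 2 ^+ n[ ].

Definition interval_average f A : R :=
  (fine (mu A))^-1 * \int[mu]_(y in A) f y.

(* the everywhere defined version of E(f | F_n) on [0, 1[; it is 0 elsewhere *)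
Definition dyadic_condexp f n x : R :=
  \sum_(k < 2 ^ n)
    interval_average f (dyadic_interval n k) * \1_(dyadic_interval n k) x.

(* meaningful for 1 <= n only *)
Definition martingale_difference f n x : R :=
  dyadic_condexp f n x - dyadic_condexp f n.-1 x.

Definition square_function f x : \bar R :=
  sqrte (\sum_(1 <= n <oo) (`|martingale_difference f n x| ^+ 2)%:E)%E.

Definition norm1 (g : R -> \bar R) : \bar R :=
  (\int[mu]_(x in `[0%R, 1%R[) `|g x|)%E.

Definition borel_subset_of_measure p A : Prop :=
  [/\ measurable A, A `<=` `[0, 1[ & mu A = p%:E].

End dyadic_square_function.

Section brownian_motion.
Context {R : realType} {d : measure_display} {T : measurableType d}.
Variable P : probability T R.

Definition mutually_independent (I : finType) (X : I -> T -> R) : Prop :=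
  forall (J : {set I}) (U : I -> set R), (forall i, measurable (U i)) ->
    P (\bigcap_(i in [set` J]) (X i @^-1` U i)) =
    (\prod_(i in J) P (X i @^-1` U i))%E.

(* Only the times t >= 0 matter: [B t] is an arbitrary random variable for
   t < 0. The second parameter of [normal_prob] is the standard deviation. *)
Record brownian_motion (p : R) (B : R -> {RV P >-> R}) : Prop := {
  brownian_start : {ae P, forall w, B 0 w = p} ;
  brownian_independent_increments : forall (n : nat) (t : nat -> R),
    0 <= t 0%N -> nondecreasing_seq t ->
    mutually_independent (fun (i : 'I_n) w => B (t i.+1) w - B (t i) w) ;
  brownian_gaussian_increments : forall (s t : R) (U : set R),
    0 <= s -> s < t -> measurable U ->
    P ((fun w => B t w - B s w) @^-1` U) = normal_prob 0 (Num.sqrt (t - s)) U ;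
  brownian_continuous_paths :
    {ae P, forall w, {within `[0, +oo[, continuous (fun t : R => B t w : R)}}
}.

(* +oo if the path never leaves ]0, 1[, as ereal_inf set0 = +oo *)
Definition exit_time (B : R -> {RV P >-> R}) (w : T) : \bar R :=
  ereal_inf [set t%:E | t in [set t : R | 0 <= t /\ ~ (0 < B t w < 1)]].

End brownian_motion.

(* Main.v *)
(* For t <> 0 put c_t(x) = cosh (t (x - 1/2)) / cosh (t / 2). The identity
   K sqrt s = \int_R (1 - exp (- t^2 s / 2)) / t^2 dt, with 0 < K < +oo, reduces
   both sides to Laplace transforms. As exp (- t^2 s / 2) cosh (t (x - 1/2)) is
   a martingale along (s, B_s), the transform of tau at t^2 / 2 is c_t(p). For a
   dyadic martingale f_n with jumps d_n,
     cosh (t (f + d)) + cosh (t (f - d)) = 2 cosh (t f) cosh (t d)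
   and cosh (t d) <= exp ((t d)^2 / 2) make exp (- t^2 S_n^2 / 2) c_t(f_n)
   decrease in mean; since f_n tends to the indicator of A, where c_t = 1, this
   gives E exp (- t^2 S^2 / 2) <= c_t(p), hence ||S||_1 >= E sqrt tau.
   Conversely 1 - (t d)^4 / 4 <= exp (- (t d)^2 / 2) cosh (t d), so a martingale
   with jumps at most h loses only O(h^2); the walk with steps
   min (h, f, 1 - f), stopped at a level where E f (1 - f) <= h, comes from a
   set A with ||S||_1 <= E sqrt tau + 2 sqrt (2 h). *)
Require Import Defs.
From HB Require Import structures.
From mathcomp Require Import all_boot all_order all_algebra.
From mathcomp Require Import all_classical all_reals all_analysis.
From mathcomp Require Import measurable_realfun.
From mathcomp Require Import ring lra.
Set Implicit Arguments.
Unset Strict Implicit.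
Unset Printing Implicit Defensive.
Import Order.TTheory GRing.Theory Num.Theory.
Import numFieldTopology.Exports numFieldNormedType.Exports.
Local Open Scope classical_set_scope.
Local Open Scope ring_scope.

(** Both inequalities are proved for each [t] separately and only then integrated against dt / t^2.
    An error of order t^4 h^2 is not integrable there at infinity, so for t^2 h >= 1 the trivial
    bound 1 replaces it; the resulting min (1, t^2 h) is at most twice the numerator of the kernel
    at the deterministic time 2 h, which is the origin of 2 sqrt (2 h). On the Brownian side
    optional stopping is applied to random walks only: the path is sampled at mesh 2^-m, stopped on
    leaving ]eps, 1 - eps[ or at time j, and m tends to infinity before j does. Sampling can miss a
    time at which the path merely touches the boundary of the window, so the limit in m need not be
    the exit time of the window. It is still at most the exit time of ]0,
    1[, since the closed window lies inside ]0, 1[, and it tends to that time as eps vanishes. Paths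
    are continuous only almost surely, so [exit_time] itself may fail to be measurable; a measurable
    [tau], equal to it almost everywhere, stands in for it until the very end. *)

Section hyperbolic_cosine.
Context {R : realType}.
Implicit Types x y a : R.

Definition cosh x : R := (expR x + expR (- x)) / 2.

Let expRp x : 0 < expR x /\ 0 < expR (- x) /\ expR x * expR (- x) = 1.
Proof. by rewrite !expR_gt0 expRxMexpNx_1. Qed.

Lemma cosh_even x : cosh (- x) = cosh x.
Proof. by rewrite /cosh opprK addrC. Qed.

Lemma coshD_B x a : cosh (x + a) + cosh (x - a) = 2 * cosh x * cosh a.
Proof. by rewrite /cosh !opprD opprK !expRD; field. Qed.

Lemma cosh_gt0 x : 0 < cosh x.
Proof. by rewrite /cosh; have [? [? _]] := expRp x; lra. Qed.

Lemma nonneg_derive_ge (f df : R -> R) :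
  (forall x, is_derive x (1:R) f (df x)) -> (forall x, 0 <= x -> 0 <= df x) ->
  forall x, 0 <= x -> f 0 <= f x.
Proof.
move=> fdf df0 x x0.
have cf : {within `[0, x], continuous f}.
  apply: continuous_subspaceT => y; apply: differentiable_continuous.
  by apply/derivable1_diffP; have [] := fdf y.
have [c] := MVT_segment x0 (fun y _ => fdf y) cf.
rewrite in_itv/= => /andP[c0 _] /eqP; rewrite subr_eq => /eqP ->.
by rewrite lerDr subr0 mulr_ge0// df0.
Qed.

Lemma sinh_ge x : 0 <= x -> x <= (expR x - expR (- x)) / 2.
Proof.
move=> x0.
have := @nonneg_derive_ge (fun y => expR y - expR (- y) - 2 * y)
  (fun y => expR y + expR (- y) - 2) _ _ x x0.
rewrite oppr0 mulr0 subrr subr0 => H.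
suff : 0 <= expR x - expR (- x) - 2 * x by lra.
apply: H => y.
  apply: is_derive_eq; rewrite /= /GRing.scale/=; ring.
by move=> _; have := expR_ge1Dx y; have := expR_ge1Dx (- y); lra.
Qed.

(** Half-angle formula: [cosh x - 1] is half the square of exp (x / 2) - exp (- x / 2), and
    [sinh_ge] bounds that difference below by [x]. *)
Lemma cosh_ge x : 1 + x ^+ 2 / 2 <= cosh x.
Proof.
wlog x0 : x / 0 <= x => [H|].
  have [/H//|/ltW] := leP 0 x; rewrite -oppr_ge0 => /H.
  by rewrite sqrrN cosh_even.
have /sinh_ge : 0 <= x / 2 by lra.
have [a0 [b0 ab]] := expRp (x / 2).
have e1 : expR x = expR (x / 2) ^+ 2 by rewrite -expRM_natl; congr expR; field.
have e2 : expR (- x) = expR (- (x / 2)) ^+ 2.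
  by rewrite -expRM_natl; congr expR; field.
rewrite /cosh e1 e2; move: (expR (x / 2)) (expR (- _)) a0 b0 ab.
move=> a b a0 b0 ab xab; have : x ^+ 2 <= (a - b) ^+ 2
  by rewrite ler_sqr ?nnegrE; lra.
by rewrite sqrrB ab; lra.
Qed.

Lemma sinh_le x : 0 <= x -> (expR x - expR (- x)) <= x * (expR x + expR (- x)).
Proof.
move=> x0.
have := @nonneg_derive_ge
  (fun y => y * (expR y + expR (- y)) - (expR y - expR (- y)))
  (fun y => y * (expR y - expR (- y))) _ _ x x0.
rewrite oppr0 mul0r subrr subrr subr_ge0; apply => y.
  apply: is_derive_eq; rewrite /= /GRing.scale/=; ring.
by move=> y0; rewrite mulr_ge0//; have := sinh_ge y0; lra.
Qed.

(** The product of [cosh y] and exp (- y^2 / 2) is nonincreasing for y >= 0: up to a positive factor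
    its derivative is sinh y - y cosh y, which has the right sign by [sinh_le]. *)
Lemma cosh_le x : cosh x <= expR (x ^+ 2 / 2).
Proof.
wlog x0 : x / 0 <= x => [H|].
  have [/H//|/ltW] := leP 0 x; rewrite -oppr_ge0 => /H.
  by rewrite sqrrN cosh_even.
pose E (y : R) := expR (- (y ^+ 2 / 2)).
have dE y : is_derive y (1:R) E (- y * E y).
  have h : is_derive y (1:R) (fun y => - (y ^+ 2 / 2)) (- y).
    apply: is_derive_eq; rewrite /= /GRing.scale/=.
    by field.
  have := @is_derive1_comp _ expR _ y _ _ (is_derive_expR _) h.
  by rewrite /E/= mulrC.
have := @nonneg_derive_ge
  (fun y => - ((expR y + expR (- y)) * E y))
  (fun y => E y * (y * (expR y + expR (- y)) - (expR y - expR (- y)))) _ _ x x0.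
rewrite /E oppr0 expr0n/= mul0r oppr0 expR0 mulr1 => H.
have {H} : (expR x + expR (- x)) * expR (- (x ^+ 2 / 2)) <= 1 + 1.
  rewrite -lerN2; apply: H => y.
    apply: is_derive_eq; rewrite /= /GRing.scale/=/E; ring.
  by move=> y0; rewrite mulr_ge0 ?expR_ge0// subr_ge0 sinh_le.
rewrite [expR (- (_ / _))]expRN ler_pdivrMr ?expR_gt0// /cosh; lra.
Qed.

Lemma ler_cosh x y : `|x| <= `|y| -> cosh x <= cosh y.
Proof.
have coshN z : cosh `|z| = cosh z.
  have [z0|z0] := leP 0 z; first by rewrite ger0_norm.
  by rewrite ltr0_norm// cosh_even.
move=> xy; rewrite -(coshN x) -(coshN y).
have := normr_ge0 x; move: `|x| `|y| xy => {coshN}{}x {}y xy x0; rewrite /cosh.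
have [a0 [b0 ab]] := expRp x; have [c0 [d0 cd]] := expRp y.
have ac : expR x <= expR y by rewrite ler_expR.
have a1 : 1 <= expR x by rewrite -expR0 ler_expR.
rewrite ler_pM2r// -subr_ge0.
move: (expR x) (expR y) (expR (- x)) (expR (- y)) a0 b0 ab c0 d0 cd ac a1.
move=> a c b d a0 b0 ab c0 d0 cd ac a1.
have -> : c + d - (a + b) = (c - a) * (1 - b * d).
  rewrite mulrBr mulr1 mulrBl [c * _]mulrCA cd mulrA ab; ring.
rewrite mulr_ge0 ?subr_ge0//; nra.
Qed.

(** With s = x^2 this is (1 - s / 2) (1 + s / 2) = 1 - s^2 / 4, one factor from the tangent bound on
    exp, the other from [cosh_ge]. *)
Lemma cosh_exp_ge x : 1 - x ^+ 4 / 4 <= expR (- (x ^+ 2 / 2)) * cosh x.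
Proof.
have h1 := cosh_ge x; have h2 := expR_ge1Dx (- (x ^+ 2 / 2)).
have h3 := expR_gt0 (- (x ^+ 2 / 2)); have h4 := cosh_gt0 x.
have -> : x ^+ 4 = (x ^+ 2) ^+ 2 by rewrite -exprM.
have := sqr_ge0 x; move: (x ^+ 2) (expR _) (cosh x) h1 h2 h3 h4 => s e c *.
have : (1 + s / 2) * e <= e * c by nra.
nra.
Qed.

End hyperbolic_cosine.

(** * Change of scale for Lebesgue measure *)

Section lebesgue_scaling.
Context {R : realType}.
Local Notation mu := (@lebesgue_measure R).

Lemma lebesgue_measureM (c : R) (A : set R) : 0 < c -> measurable A ->
  (c%:E * mu ( *%R c @^-1` A) = mu A)%E.
Proof.
move=> c0 mA.
have mc : measurable_fun setT ( *%R c : measurableTypeR R -> measurableTypeR R).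
  by apply: measurable_funM => //.
pose cn := NngNum (ltW c0).
pose m := mscale cn (pushforward mu ( *%R c : measurableTypeR R ->
  measurableTypeR R)).
suff : mu A = m mc A by move=> ->.
apply: lebesgue_measure_unique => // _ [[a b]] _ <-.
transitivity (c%:E * mu ( *%R c @^-1` `]a, b]))%E; last by [].
have -> : *%R c @^-1` `]a, b] = `]a / c, b / c]%classic.
  apply/seteqP; split=> x/=;
  by rewrite !in_itv/= ltr_pdivrMr// ler_pdivlMr// mulrC.
rewrite !lebesgue_measure_itv/= !lte_fin ltr_pM2r ?invr_gt0//.
case: ifPn => _; last by rewrite mule0.
by rewrite -!EFinD -EFinM; congr EFin; field; lra.
Qed.

Lemma ge0_integral_lebesgueM (c : R) (f : R -> \bar R) : 0 < c ->
  measurable_fun setT f -> (forall x, 0 <= f x)%E ->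
  (\int[mu]_x f x = c%:E * \int[mu]_x f (c * x)%R)%E.
Proof.
move=> c0 mf f0.
have mc : measurable_fun setT ( *%R c : measurableTypeR R -> measurableTypeR R).
  by apply: measurable_funM => //.
pose cn := NngNum (ltW c0).
pose m := mscale cn (pushforward mu ( *%R c : measurableTypeR R ->
  measurableTypeR R)).
have -> : (\int[mu]_x f (c * x)%R =
   \int[pushforward mu ( *%R c : measurableTypeR R -> measurableTypeR R)]_x f
     x)%E.
  by rewrite ge0_integral_pushforward.
transitivity (\int[m mc]_x f x)%E; last by rewrite ge0_integral_mscale.
by apply: eq_measure_integral => //= A mA _; exact/esym/lebesgue_measureM.
Qed.

End lebesgue_scaling.

(** * The square root as a mixture of Laplace transforms *)

Section bernstein.
Context {R : realType}.
Local Notation mu := (@lebesgue_measure R).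
Implicit Types (t r : R) (s : \bar R).

(* exp (- t ^ 2 s / 2), with the value 0 at [s = +oo] for every [t]. *)
Definition laplace t s : R :=
  if s is r%:E then expR (- (t ^+ 2 / 2 * r)) else 0.

(* At [t = 0] both the numerator and the inverse vanish. *)
Definition levy_kernel t s : \bar R := ((1 - laplace t s) / t ^+ 2)%:E.

Lemma laplace_ge0 t s : 0 <= laplace t s.
Proof. by case: s => //= r; exact: expR_ge0. Qed.

Lemma laplace_le1 t s : (0 <= s)%E -> laplace t s <= 1.
Proof.
case: s => //= r; rewrite lee_fin => r0.
by rewrite -expR0 ler_expR oppr_le0 mulr_ge0// divr_ge0// sqr_ge0.
Qed.

Lemma levy_kernel_ge0 t s : (0 <= s)%E -> (0 <= levy_kernel t s)%E.
Proof.
by move=> s0; rewrite lee_fin divr_ge0 ?sqr_ge0// subr_ge0 laplace_le1.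
Qed.

Lemma laplace0 t : laplace t 0 = 1.
Proof. by rewrite /= mulr0 oppr0 expR0. Qed.

Lemma levy_kernel0 t : levy_kernel t 0 = 0%E.
Proof. by rewrite /levy_kernel laplace0 subrr mul0r. Qed.

Lemma measurable_laplace d (X : measurableType d) (t : X -> R) (s : X ->
  \bar R) :
  measurable_fun setT t -> measurable_fun setT s ->
  (forall x, 0 <= s x)%E ->
  measurable_fun setT (fun x => laplace (t x) (s x)).
Proof.
move=> mt ms s0.
have -> : (fun x => laplace (t x) (s x)) =
  (fun x => (\1_(s @^-1` [set~ +oo%E]) x *
             expR (- (t x ^+ 2 / 2 * fine (s x))))%R).
  apply/funext => x; have := s0 x; rewrite indicE.
  case sx : (s x) => [r| |]// _ /=.
    by rewrite mem_set ?mul1r//= sx.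
  by rewrite memNset ?mul0r//= => /(_ sx).
apply: measurable_funM.
  apply: measurable_indic; rewrite -[X in measurable X]setTI; apply: ms => //.
  by apply: measurableC; exact: emeasurable_set1.
apply: measurableT_comp => //; apply: measurableT_comp => //.
apply: measurable_funM.
  by apply: measurable_funM => //; exact: measurable_funX.
by apply: measurableT_comp => //.
Qed.

Lemma measurable_levy_kernel d (X : measurableType d) (t : X -> R)
    (s : X -> \bar R) :
  measurable_fun setT t -> measurable_fun setT s -> (forall x, 0 <= s x)%E ->
  measurable_fun setT (fun x => levy_kernel (t x) (s x)).
Proof.
move=> mt ms s0; apply/measurable_EFinP; apply: measurable_funM.
  by apply: measurable_funB => //; exact: measurable_laplace.
under eq_fun do rewrite -powR_inv1 ?sqr_ge0//.
by apply: (measurableT_comp (measurable_powR _)); exact: measurable_funX.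
Qed.

(* The value of this constant is irrelevant, only that it is positive and
   finite. *)
Definition levy_const : \bar R := (\int[mu]_t levy_kernel t 1%:E)%E.

Lemma levy_const_gt0 : (0 < levy_const)%E.
Proof.
(* On [1, 2] the numerator is at least 1 - exp (- 1 / 2) and the denominator at most 4. *)
pose k : R := (1 - expR (- 2^-1)) / 4.
have k0 : 0 < k by rewrite divr_gt0// subr_gt0 expR_lt1; lra.
have mk := @measurable_levy_kernel _ _ id (fun=> 1%:E) (@measurable_id _ _ _)
   (@measurable_cst _ _ _ _ _ _) (fun=> lee01).
apply: (@lt_le_trans _ _ (\int[mu]_(t in `[1%R, 2%R]) (cst k%:E) t)%E).
  rewrite integral_cst//= lebesgue_measure_itv/= lte_fin ltr1n.
  by rewrite -EFinD mule_gt0// lte_fin; lra.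
apply: (@le_trans _ _ (\int[mu]_(t in `[1%R, 2%R]) levy_kernel t 1%:E)%E);
  last first.
  apply: ge0_subset_integral => //= t _; exact: levy_kernel_ge0.
apply: ge0_le_integral => //=.
- by move=> t _; rewrite lee_fin ltW.
- exact: measurable_funTS.
move=> t; rewrite in_itv/= => /andP[t1 t2]; rewrite lee_fin.
have u1 : 1 <= t ^+ 2 by rewrite expr2; nra.
have u2 : t ^+ 2 <= 4 by rewrite expr2; nra.
rewrite /k /= mulr1 ler_pM ?invr_ge0//.
- by rewrite lerD2l lerN2 ler_expR; lra.
- by rewrite lef_pV2// posrE; lra.
Qed.

(** The integrand is at most 2 / (1 + t^2), an arctangent derivative. In [key], with u = t^2, the
    case u <= 1 uses 1 - e <= u / 2 and the case u >= 1 uses 1 - e <= 1. *)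
Lemma levy_const_lty : (levy_const < +oo)%E.
Proof.
have key (e u : R) : 0 < u -> 0 < e -> 1 - u / 2 <= e ->
    (1 - e) * (1 + u) <= 2 * u.
  by move=> u0 e0 e1; have [u1|/ltW u1] := leP u 1; nra.
have mk := @measurable_levy_kernel _ _ id (fun=> 1%:E) (@measurable_id _ _ _)
   (@measurable_cst _ _ _ _ _ _) (fun=> lee01).
have V0 (t : R) : 0 <= (oneDsqr t)^-1.
  by rewrite invr_ge0; apply: le_trans (oneDsqr_ge1 t).
apply: (@le_lt_trans _ _ (\int[mu]_t (2 * (oneDsqr t)^-1)%:E)%E).
  apply: ge0_le_integral => //=.
  - by move=> t _; exact: levy_kernel_ge0.
  - apply/measurable_EFinP; apply: measurable_funM => //.
    by apply: continuous_measurable_fun; exact: continuous_oneDsqrV.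
  move=> t _; rewrite lee_fin /= mulr1 /oneDsqr.
  have [->|t0] := eqVneq t 0.
    by rewrite expr0n/= invr0 mulr0 addr0 invr1; lra.
  have u0 : 0 < t ^+ 2 by rewrite exprn_even_gt0.
  have e0 := expR_gt0 (- (t ^+ 2 / 2)).
  have e1 := expR_ge1Dx (- (t ^+ 2 / 2)).
  rewrite ler_pdivrMr// [leRHS]mulrAC ler_pdivlMr; last by lra.
  exact: key.
under eq_integral do rewrite EFinM.
have mV : measurable_fun setT (fun t : R => (oneDsqr t)^-1).
  by apply: continuous_measurable_fun; exact: continuous_oneDsqrV.
rewrite ge0_integralZl//; last exact/measurable_EFinP.
rewrite ge0_symfun_integralT//; first last.
- by move=> t; rewrite /= /oneDsqr sqrrN.
- exact: continuous_oneDsqrV.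
by rewrite -set_itvcy integral0y_oneDsqr -!EFinM ltry.
Qed.

(* Substituting [sqrt r * t] for [t] scales the integral by [sqrt r]. *)
Lemma integral_levy_kernel s : (0 <= s)%E ->
  (\int[mu]_t levy_kernel t s = levy_const * sqrte s)%E.
Proof.
have fin r : 0 <= r ->
  (\int[mu]_t levy_kernel t r%:E = levy_const * sqrte r%:E)%E.
  rewrite le_eqVlt => /predU1P[<-|r0].
    by rewrite sqrte0 mule0; apply: integral0_eq => t _; exact: levy_kernel0.
  have c0 : 0 < Num.sqrt r by rewrite sqrtr_gt0.
  have mk q : 0 <= q -> measurable_fun setT (fun t : R => levy_kernel t q%:E).
    by move=> q0; apply: measurable_levy_kernel => // x; rewrite lee_fin.
  rewrite /levy_const [in RHS](ge0_integral_lebesgueM c0); first last.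
  - by move=> x; exact: levy_kernel_ge0.
  - exact: mk.
  have E t : levy_kernel (Num.sqrt r * t) 1%:E =
    (r^-1%:E * levy_kernel t r%:E)%E.
    rewrite /levy_kernel -EFinM; congr EFin.
    rewrite /laplace mulr1 exprMn sqr_sqrtr ?ltW// invfM mulrCA.
    by congr (_ * ((1 - expR (- _)) / _)); field.
  under [in RHS]eq_integral do rewrite E.
  rewrite ge0_integralZl//; first last.
    by rewrite lee_fin invr_ge0 ltW.
    by move=> x _; apply: levy_kernel_ge0; rewrite lee_fin ltW.
    by apply: mk; rewrite ltW.
  rewrite [sqrte _]/= muleC !muleA -!EFinM -expr2 sqr_sqrtr ?ltW//.
  by rewrite divff ?mul1e// gt_eqF.
case: s => [r|_|]//; first by rewrite lee_fin; exact: fin.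
rewrite [sqrte _]/= gt0_muley ?levy_const_gt0//.
have K0 := levy_const_gt0; have Ky := levy_const_lty.
have Kfin : levy_const \is a fin_num by rewrite ge0_fin_numE// ltW.
have k0 : 0 < fine levy_const by rewrite fine_gt0// K0.
apply/eqyP => A A0.
pose r := (A / fine levy_const) ^+ 2.
have -> : (A%:E = \int[mu]_t levy_kernel t r%:E)%E.
  rewrite fin ?sqr_ge0// [sqrte _]/= sqrtr_sqr ger0_norm; last first.
    by rewrite divr_ge0// ltW.
  by rewrite -[in X in (X * _)%E](fineK Kfin) -EFinM mulrCA divff ?mulr1//
    gt_eqF.
apply: ge0_le_integral => //=.
- by move=> t _; apply: levy_kernel_ge0; rewrite lee_fin sqr_ge0.
- by apply: measurable_levy_kernel => // t; rewrite lee_fin sqr_ge0.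
- by apply: measurable_levy_kernel.
move=> t _; rewrite lee_fin ler_wpM2r// ?invr_ge0 ?sqr_ge0//.
by rewrite lerD2l lerN2 expR_ge0.
Qed.

Lemma measurable_sqrte d (X : measurableType d) (s : X -> \bar R) :
  measurable_fun setT s -> (forall x, 0 <= s x)%E ->
  measurable_fun setT (fun x => sqrte (s x)).
Proof.
move=> ms s0; under eq_fun do rewrite -poweR12_sqrt//.
exact: (measurableT_comp (measurable_poweR _)).
Qed.

(** Tonelli applied to [integral_levy_kernel]. The measure is general because the identity serves
    both for the Brownian probability and for Lebesgue measure. *)
Lemma levy_const_integral_sqrte d (X : measurableType d)
    (m : {sigma_finite_measure set X -> \bar R}) (s : X -> \bar R) :
  measurable_fun setT s -> (forall x, 0 <= s x)%E ->
  (levy_const * \int[m]_x sqrte (s x) =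
   \int[mu]_t \int[m]_x levy_kernel t (s x))%E.
Proof.
move=> ms s0; rewrite -ge0_integralZl//; first last.
- exact/ltW/levy_const_gt0.
- by move=> x _; exact: sqrte_ge0.
- exact: measurable_sqrte.
under eq_integral do rewrite -integral_levy_kernel//.
rewrite (@fubini_tonelli _ _ _ _ _ m mu (fun z => levy_kernel z.2 (s z.1)))//.
- apply: measurable_levy_kernel => //.
  exact: measurableT_comp.
- by move=> z; exact: levy_kernel_ge0.
Qed.

End bernstein.

(** * Dyadic martingales as arrays of values *)

Section dyadic_arrays.
Context {R : realType}.
Implicit Types (c v : nat -> R) (n k : nat) (t : R).

Definition dyadic_mean n (c : nat -> R) : R :=
  (2 ^+ n)^-1 * \sum_(0 <= k < 2 ^ n) c k.

Lemma sum_double n c :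
  \sum_(0 <= k < n.*2) c k = \sum_(0 <= k < n) (c k.*2 + c k.*2.+1).
Proof.
elim: n => [|n IH]; first by rewrite !big_nil.
by rewrite doubleS !big_nat_recr//= IH addrA.
Qed.

Lemma dyadic_meanS n c :
  dyadic_mean n.+1 c = dyadic_mean n (fun k => (c k.*2 + c k.*2.+1) / 2).
Proof.
rewrite /dyadic_mean expnS mul2n sum_double -mulr_suml exprS invfM.
by rewrite -mulrA mulrC -mulrA.
Qed.

Lemma dyadic_mean0 c : dyadic_mean 0 c = c 0%N.
Proof. by rewrite /dyadic_mean expn0 big_nat1 expr0 invr1 mul1r. Qed.

Lemma le_dyadic_mean n (c c' : nat -> R) : (forall k, c k <= c' k) ->
  dyadic_mean n c <= dyadic_mean n c'.
Proof.
by move=> cc; rewrite ler_wpM2l ?invr_ge0 ?exprn_ge0// ler_sum.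
Qed.

Lemma eq_dyadic_mean n (c c' : nat -> R) : c =1 c' ->
  dyadic_mean n c = dyadic_mean n c'.
Proof. by move=> cc; congr (_ * _); apply: eq_bigr. Qed.

Lemma dyadic_meanD n (c c' : nat -> R) :
  dyadic_mean n (fun k => c k + c' k) = dyadic_mean n c + dyadic_mean n c'.
Proof. by rewrite /dyadic_mean big_split mulrDr. Qed.

Lemma dyadic_meanZ n x c :
  dyadic_mean n (fun k => x * c k) = x * dyadic_mean n c.
Proof. by rewrite /dyadic_mean -mulr_sumr mulrCA. Qed.

Lemma dyadic_mean_cst n x : dyadic_mean n (fun=> x) = x.
Proof.
elim: n => [|n IH]; first by rewrite dyadic_mean0.
by rewrite dyadic_meanS -[RHS]IH; apply: eq_dyadic_mean => k; field.
Qed.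

Lemma dyadic_meanB n (c c' : nat -> R) :
  dyadic_mean n (fun k => c k - c' k) = dyadic_mean n c - dyadic_mean n c'.
Proof.
rewrite -[- dyadic_mean n c']mulN1r -dyadic_meanZ -dyadic_meanD.
by apply: eq_dyadic_mean => k; rewrite mulN1r.
Qed.

(* [v n k] is the value of a martingale on the dyadic interval
   [[k / 2 ^ n, (k + 1) / 2 ^ n[]. *)
Definition dyadic_martingale (v : nat -> nat -> R) :=
  forall n k, v n k = (v n.+1 k.*2 + v n.+1 k.*2.+1) / 2.

Fixpoint square_sum (v : nat -> nat -> R) n k : R :=
  if n is m.+1 then square_sum v m k./2 + (v n k - v m k./2) ^+ 2 else 0.

Section martingale.
Variable v : nat -> nat -> R.
Hypothesis mv : dyadic_martingale v.
Hypothesis v01 : forall n k, 0 <= v n k <= 1.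

Let jump n k := v n.+1 k.*2.+1 - v n k.

(** The two halves of an interval carry opposite jumps, so the square sum takes the same value on
    both. All one-step computations below are instances for a suitable [F]. *)
Lemma dyadic_mean_step (F : R -> R -> R) n :
  dyadic_mean n.+1 (fun k => F (v n.+1 k) (square_sum v n.+1 k)) =
  dyadic_mean n (fun k =>
    (F (v n k - jump n k) (square_sum v n k + jump n k ^+ 2) +
     F (v n k + jump n k) (square_sum v n k + jump n k ^+ 2)) / 2).
Proof.
rewrite dyadic_meanS; apply: eq_dyadic_mean => k /=.
rewrite doubleK uphalf_double -/(jump n k).
have E : v n.+1 k.*2 = v n k - jump n k.
  by rewrite /jump; have := mv n k; lra.
rewrite E [v n.+1 _.+1](_ : _ = v n k + jump n k); last by rewrite /jump; lra.
by congr ((F _ (_ + _) + _) / 2); ring.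
Qed.

Lemma square_sum_ge0 n k : 0 <= square_sum v n k.
Proof. by elim: n k => //= n IH k; rewrite addr_ge0 ?sqr_ge0. Qed.

Lemma dyadic_mean_martingale n : dyadic_mean n (v n) = v 0 0.
Proof.
elim: n => [|n IH]; first by rewrite dyadic_mean0.
rewrite (dyadic_mean_step (fun x _ => x)) -[RHS]IH.
by apply: eq_dyadic_mean => k; field.
Qed.

(** Orthogonality of the jumps: the average of (x - a)^2 and (x + a)^2 is x^2 + a^2. *)
Lemma dyadic_mean_square_sum n :
  dyadic_mean n (square_sum v n) = dyadic_mean n (fun k => v n k ^+ 2) - v 0 0
    ^+ 2.
Proof.
elim: n => [|n IH]; first by rewrite !dyadic_mean0 subrr.
rewrite (dyadic_mean_step (fun _ s => s))
  (dyadic_mean_step (fun x _ => x ^+ 2)).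
apply/eqP; rewrite -subr_eq0 opprB addrA subr_eq0; apply/eqP.
move/eqP: IH; rewrite eq_sym subr_eq => /eqP IH.
rewrite [RHS](_ : _ = dyadic_mean n (fun k => v n k ^+ 2 + jump n k ^+ 2));
  last first.
  by apply: eq_dyadic_mean => k; field.
rewrite dyadic_meanD IH -addrA [_ + (_ + _)]addrCA addrC; congr +%R.
by rewrite -dyadic_meanD; apply: eq_dyadic_mean => k; field.
Qed.

Lemma dyadic_mean_square_sumS n :
  dyadic_mean n.+1 (square_sum v n.+1) =
  dyadic_mean n (square_sum v n) + dyadic_mean n (fun k => jump n k ^+ 2).
Proof.
rewrite (dyadic_mean_step (fun _ s => s)) -dyadic_meanD.
by apply: eq_dyadic_mean => k; field.
Qed.

Lemma dyadic_mean_square_sum_le n : dyadic_mean n (square_sum v n) <= 1.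
Proof.
rewrite dyadic_mean_square_sum.
have : dyadic_mean n (fun k => v n k ^+ 2) <= dyadic_mean n (fun=> 1).
  by apply: le_dyadic_mean => k; have := v01 n k; nra.
by rewrite dyadic_mean_cst; have := sqr_ge0 (v 0 0); lra.
Qed.

(** The left side is the growth of the mean of v^2. As v^2 <= v and the mean of v is constant, that
    growth is at most the mean of v - v^2 at level [n]. *)
Lemma dyadic_mean_square_sum_tail n m : (n <= m)%N ->
  dyadic_mean m (square_sum v m) - dyadic_mean n (square_sum v n) <=
  dyadic_mean n (fun k => v n k * (1 - v n k)).
Proof.
move=> nm; rewrite !dyadic_mean_square_sum.
rewrite [leRHS](_ : _ = dyadic_mean n (v n) - dyadic_mean n
  (fun k => v n k ^+ 2)).
  have : dyadic_mean m (fun k => v m k ^+ 2) <= dyadic_mean m (v m).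
    by apply: le_dyadic_mean => k; have := v01 m k; nra.
  by rewrite !dyadic_mean_martingale; lra.
by rewrite -dyadic_meanB; apply: eq_dyadic_mean => k; ring.
Qed.

Section laplace.
Variable t : R.

Let e (s : R) := expR (- (t ^+ 2 / 2 * s)).

Let eD s a : e (s + a) = e s * e a.
Proof. by rewrite /e mulrDr opprD expRD. Qed.

Let e1 s : 0 <= s -> e s <= 1.
Proof.
by move=> s0; rewrite -expR0 ler_expR oppr_le0 mulr_ge0// divr_ge0 ?sqr_ge0.
Qed.

Let F n := dyadic_mean n (fun k => e (square_sum v n k) *
  cosh (t * (v n k - 2^-1))).

Let F_step n : F n.+1 = dyadic_mean n (fun k =>
  e (square_sum v n k) * cosh (t * (v n k - 2^-1)) *
  (e (jump n k ^+ 2) * cosh (t * jump n k))).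
Proof.
rewrite /F (dyadic_mean_step (fun x s => e s * cosh (t * (x - 2^-1)))).
apply: eq_dyadic_mean => k; rewrite eD -mulrDr.
have := coshD_B (t * (v n k - 2^-1)) (t * jump n k).
rewrite -mulrDr -mulrBr ![v n k - 2^-1 + _]addrAC => H.
by rewrite [cosh _ + cosh _]addrC H; field.
Qed.

Lemma cosh_unit_interval x : 0 <= x <= 1 ->
  cosh (t * (x - 2^-1)) <= cosh (t / 2).
Proof.
move=> x01; apply: ler_cosh; rewrite !normrM ler_wpM2l//.
by rewrite [leRHS]ger0_norm ?invr_ge0// ler_norml; lra.
Qed.

(* Splitting an interval multiplies the summand by
   [exp (- (t a) ^ 2 / 2) * cosh (t a) <= 1], with [a] the jump. *)
Lemma dyadic_mean_laplace_le n :
  dyadic_mean n (fun k => expR (- (t ^+ 2 / 2 * square_sum v n k)) *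
    cosh (t * (v n k - 2^-1))) <= cosh (t * (v 0 0 - 2^-1)).
Proof.
rewrite -/(F n); elim: n => [|n IH].
  by rewrite /F dyadic_mean0/= /e mulr0 oppr0 expR0 mul1r.
apply: le_trans IH; rewrite F_step; apply: le_dyadic_mean => k.
rewrite ler_piMr ?mulr_ge0 ?expR_ge0 ?(ltW (cosh_gt0 _))//.
rewrite /e expRN mulrC ler_pdivrMr ?expR_gt0// mul1r.
apply: le_trans (cosh_le _) _; rewrite ler_expR exprMn.
by rewrite mulrAC.
Qed.

(** By [cosh_exp_ge] a jump a multiplies the summand by at least 1 - (t a)^4 / 4, and a^4 <= h^2
    a^2. The losses thus add up to a multiple of h^2 times the mean of the square sum, which never
    exceeds 1. *)
Lemma dyadic_mean_laplace_ge h n :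
  (forall m k, (m < n)%N -> `|v m.+1 k - v m k./2| <= h) ->
  cosh (t * (v 0 0 - 2^-1)) - (t ^+ 2 / 2) ^+ 2 * h ^+ 2 * cosh (t / 2) <=
  dyadic_mean n (fun k => expR (- (t ^+ 2 / 2 * square_sum v n k)) *
    cosh (t * (v n k - 2^-1))).
Proof.
move=> vh; rewrite -/(F n).
have H m : (m <= n)%N -> cosh (t * (v 0 0 - 2^-1)) - (t ^+ 2 / 2) ^+ 2 *
  h ^+ 2 * cosh (t / 2)
    * dyadic_mean m (square_sum v m) <= F m.
  elim: m => [_|m IH mn].
    by rewrite /F !dyadic_mean0/= /e !mulr0 oppr0 expR0 mul1r addr0.
  rewrite dyadic_mean_square_sumS F_step.
  have {}IH := IH (ltnW mn).
  pose C := (t ^+ 2 / 2) ^+ 2 * h ^+ 2 * cosh (t / 2); rewrite -/C in IH *.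
  have C0 : 0 <= C.
    by apply: mulr_ge0; [apply: mulr_ge0; exact: sqr_ge0|exact/ltW/cosh_gt0].
  suff : F m - C * dyadic_mean m (fun k => jump m k ^+ 2) <=
      dyadic_mean m (fun k =>
        e (square_sum v m k) * cosh (t * (v m k - 2^-1)) *
        (e (jump m k ^+ 2) * cosh (t * jump m k))) by lra.
  rewrite -dyadic_meanZ /F -dyadic_meanB; apply: le_dyadic_mean => k.
  have hj : jump m k ^+ 2 <= h ^+ 2.
    have := vh m k.*2.+1 mn; rewrite /= uphalf_double -/(jump m k) => hj.
    by rewrite -[_ ^+ 2]real_normK ?num_real// ler_sqr ?nnegrE ?(le_trans _ hj).
  have hc : 1 - (t * jump m k) ^+ 4 / 4 <= e (jump m k ^+ 2) *
    cosh (t * jump m k).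
    rewrite /e (_ : t ^+ 2 / 2 * _ = (t * jump m k) ^+ 2 / 2) ?cosh_exp_ge//.
    by field.
  set x := e (square_sum v m k); set y := cosh _.
  have x0 : 0 <= x by exact: expR_ge0.
  have y0 : 0 <= y by rewrite ltW ?cosh_gt0.
  have x1 : x <= 1 by apply: e1; exact: square_sum_ge0.
  have y1 : y <= cosh (t / 2) by apply: cosh_unit_interval.
  apply: le_trans (ler_wpM2l (mulr_ge0 x0 y0) hc).
  rewrite mulrBr mulr1 lerD2l lerN2.
  have xy : x * y <= cosh (t / 2) by nra.
  have xyj : x * y * jump m k ^+ 2 <= cosh (t / 2) * h ^+ 2.
    by rewrite ler_pM ?sqr_ge0// mulr_ge0.
  have -> : x * y * ((t * jump m k) ^+ 4 / 4) =
      (t ^+ 2 / 2) ^+ 2 * jump m k ^+ 2 * (x * y * jump m k ^+ 2) by field.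
  have -> : C * jump m k ^+ 2 =
      (t ^+ 2 / 2) ^+ 2 * jump m k ^+ 2 * (cosh (t / 2) * h ^+ 2).
    by rewrite /C; ring.
  by rewrite ler_wpM2l// mulr_ge0 ?sqr_ge0.
apply: le_trans (H n (leqnn n));
  rewrite lerD2l lerN2 ler_piMr ?dyadic_mean_square_sum_le//.
by apply: mulr_ge0; [apply: mulr_ge0; exact: sqr_ge0|exact/ltW/cosh_gt0].
Qed.

(** Since exp (- c a^2) >= 1 - c a^2 with c = t^2 / 2, later levels lower the mean by at most c
    times the growth of the mean square sum, whatever the size of the jumps. *)
Lemma dyadic_mean_laplace_tail n m : (n <= m)%N ->
  dyadic_mean n (fun k => expR (- (t ^+ 2 / 2 * square_sum v n k))) -
  t ^+ 2 / 2 * (dyadic_mean m (square_sum v m) - dyadic_mean n (square_sum v n))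
  <= dyadic_mean m (fun k => expR (- (t ^+ 2 / 2 * square_sum v m k))).
Proof.
elim: m => [|m IH]; first by rewrite leqn0 => /eqP n0; rewrite n0; lra.
rewrite leq_eqVlt => /predU1P[nm|]; first by rewrite nm; lra.
rewrite ltnS => /IH {}IH.
rewrite dyadic_mean_square_sumS.
have /= step := dyadic_mean_step (fun _ s => e s) m.
apply: le_trans (_ : _ <= dyadic_mean m.+1 (fun k => e (square_sum v m.+1 k))) _
  => //.
rewrite [leRHS]step {step}.
suff : dyadic_mean m (fun k => e (square_sum v m k)) - t ^+ 2 / 2 *
     dyadic_mean m (fun k => jump m k ^+ 2) <=
   dyadic_mean m (fun k => (e (square_sum v m k + jump m k ^+ 2) +
     e (square_sum v m k + jump m k ^+ 2)) / 2) by move: IH; rewrite /e; lra.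
rewrite -dyadic_meanZ -dyadic_meanB; apply: le_dyadic_mean => k.
have -> (x : R) : (x + x) / 2 = x by field.
rewrite eD.
have x1 := e1 (square_sum_ge0 m k); have x0 :=
  expR_ge0 (- (t ^+ 2 / 2 * square_sum v m k)).
have a0 := sqr_ge0 (jump m k).
have t0 : 0 <= t ^+ 2 / 2 by rewrite divr_ge0 ?sqr_ge0.
have key (x y a b : R) : 0 <= x -> x <= 1 -> 0 <= a -> 0 <= b ->
    1 + - (b * a) <= y -> x - b * a <= x * y.
  by move=> ? ? ha hb ?; have := mulr_ge0 ha hb; nra.
by apply: key => //; exact: expR_ge1Dx.
Qed.

(** Jumps are small up to level [n] and uncontrolled beyond it: the first error term is the loss
    before [n], the second pays for everything after with the variance left at [n]. Bounding the
    cosine factor at level [n] by cosh (t / 2) costs nothing in this direction. *)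
Lemma dyadic_mean_laplace_upper h n m : (n <= m)%N ->
  (forall i k, (i < n)%N -> `|v i.+1 k - v i k./2| <= h) ->
  dyadic_mean m (fun k => 1 - expR (- (t ^+ 2 / 2 * square_sum v m k))) <=
  1 - cosh (t * (v 0 0 - 2^-1)) / cosh (t / 2) +
    ((t ^+ 2 / 2) ^+ 2 * h ^+ 2 +
     t ^+ 2 / 2 * dyadic_mean n (fun k => v n k * (1 - v n k))).
Proof.
move=> nm vh; rewrite dyadic_meanB dyadic_mean_cst.
have h1 := dyadic_mean_laplace_tail nm.
have h2 := dyadic_mean_laplace_ge vh.
have c0 := cosh_gt0 (t / 2).
have h3 : dyadic_mean n (fun k => expR (- (t ^+ 2 / 2 * square_sum v n k)) *
    cosh (t * (v n k - 2^-1))) <=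
    cosh (t / 2) * dyadic_mean n
      (fun k => expR (- (t ^+ 2 / 2 * square_sum v n k))).
  rewrite -dyadic_meanZ; apply: le_dyadic_mean => k.
  by rewrite mulrC ler_wpM2r ?expR_ge0// cosh_unit_interval.
have h4 := dyadic_mean_square_sum_tail nm.
have t0 : 0 <= t ^+ 2 / 2 by rewrite divr_ge0 ?sqr_ge0.
have {}h4 := ler_wpM2l t0 h4.
have h5 : cosh (t * (v 0 0 - 2^-1)) / cosh (t / 2) - (t ^+ 2 / 2) ^+ 2 *
  h ^+ 2 <=
   dyadic_mean n (fun k => expR (- (t ^+ 2 / 2 * square_sum v n k))).
  rewrite -(ler_pM2l c0); apply: le_trans h3; apply: le_trans h2.
  by rewrite mulrBr mulrCA divff ?gt_eqF// mulr1 [cosh _ * _]mulrC.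
lra.
Qed.

End laplace.
End martingale.
End dyadic_arrays.

(** * Gaussian exponential moments and independence from the past *)

Section gaussian_laplace.
Context {R : realType}.
Local Notation mu := (@lebesgue_measure R).

Lemma ge0_integral_normal_prob (m s : R) (f : R -> \bar R) :
  measurable_fun setT f -> (forall x, 0 <= f x)%E ->
  (\int[normal_prob m s]_x f x = \int[mu]_x (f x * (normal_pdf m s x)%:E))%E.
Proof.
move=> mf f0.
rewrite -(Radon_Nikodym_SigmaFinite.change_of_variables
  (normal_prob_dominates m s) f0 measurableT mf).
have intRN :=
  Radon_Nikodym_SigmaFinite.f_integrable (normal_prob_dominates m s).
have mpdf : measurable_fun setT (fun x => (normal_pdf m s x)%:E).
  by apply/measurable_EFinP; exact: measurable_normal_pdf.
apply: ae_eq_integral => //.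
- by apply: emeasurable_funM => //; exact: measurable_int intRN.
- exact: emeasurable_funM.
apply: ae_eqe_mul2l => /=; apply: integral_ae_eq => //.
move=> E _ mE; rewrite -Radon_Nikodym_SigmaFinite.f_integral//.
exact: normal_prob_dominates.
Qed.

(** Completing the square turns exp (t x) times the centred density into a constant times the
    density of mean t s^2. *)
Lemma normal_prob_laplace (s t : R) : s != 0 ->
  (\int[normal_prob 0 s]_x (expR (t * x))%:E =
    (expR (t ^+ 2 * s ^+ 2 / 2))%:E)%E.
Proof.
move=> s0; rewrite ge0_integral_normal_prob; last 2 first.
- by apply/measurable_EFinP; apply: measurableT_comp => //;
  apply: measurable_funM.
- by move=> x; rewrite lee_fin expR_ge0.
under eq_integral => x _.
  rewrite -EFinM (_ : expR (t * x) * _ = expR (t ^+ 2 * s ^+ 2 / 2) *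
    normal_pdf (t * s ^+ 2) s x); last first.
    rewrite !normal_pdfE//.
    transitivity (normal_peak s * (expR (t * x) * normal_fun 0 s x)).
      by rewrite mulrCA.
    transitivity (normal_peak s *
      (expR (t ^+ 2 * s ^+ 2 / 2) * normal_fun (t * s ^+ 2) s x)); last first.
      by rewrite mulrCA.
    congr (_ * _).
    rewrite /normal_fun -!expRD; congr expR; rewrite -mulr_natr.
    by field.
  rewrite EFinM; over.
rewrite ge0_integralZl//.
- by rewrite integral_normal_pdf mule1.
- by apply/measurable_EFinP; exact: measurable_normal_pdf.
- by move=> x _; rewrite lee_fin normal_pdf_ge0.
Qed.

End gaussian_laplace.

Section independent_product.
Context {R : realType} d (T : measurableType d) (P : probability T R).

(** The joint law agrees with the product law on rectangles, hence everywhere; Tonelli then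
    separates the factors. *)
Lemma ge0_integral_independent (X Y : T -> R) (f g : R -> \bar R) :
  measurable_fun setT X -> measurable_fun setT Y ->
  (forall U V, measurable U -> measurable V ->
    P (X @^-1` U `&` Y @^-1` V) = P (X @^-1` U) * P (Y @^-1` V))%E ->
  measurable_fun setT f -> (forall x, 0 <= f x)%E ->
  measurable_fun setT g -> (forall x, 0 <= g x)%E ->
  (\int[P]_w (f (X w) * g (Y w)) = \int[P]_w f (X w) * \int[P]_w g (Y w))%E.
Proof.
move=> mX mY ind mf f0 mg g0.
pose X' : {RV P >-> R} := HB.pack X (isMeasurableFun.Build _ _ _ _ _ mX).
pose Y' : {RV P >-> R} := HB.pack Y (isMeasurableFun.Build _ _ _ _ _ mY).
have mXY : measurable_fun setT (fun w => (X w, Y w)).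
  exact/measurable_fun_pairP.
pose h (z : R * R) : \bar R := (f z.1 * g z.2)%E.
have mh : measurable_fun setT h.
  by apply: emeasurable_funM; exact: measurableT_comp.
have h0 z : (0 <= h z)%E by rewrite mule_ge0.
pose XY : {RV P >-> (R * R)%type} := HB.pack (fun w => (X w, Y w))
  (isMeasurableFun.Build _ _ _ _ _ mXY).
transitivity (\int[distribution P XY]_z h z)%E.
  by rewrite ge0_integral_distribution.
transitivity (\int[(distribution P X' \x distribution P Y')%E]_z h z)%E.
  apply: eq_measure_integral => A mA _ /=.
  apply/esym; apply: (product_measure_unique (m' := distribution P XY));
    last exact: mA.
  by move=> U V mU mV; exact: ind.
transitivity (\int[distribution P X']_x \int[distribution P Y']_y h (x, y))%E.
  exact: (@fubini_tonelli1 _ _ _ _ _ (distribution P X') (distribution P Y')).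
under eq_integral => x _.
  rewrite /h/= ge0_integralZl//; over.
rewrite ge0_integralZr//=; last by apply: integral_ge0.
rewrite (@ge0_integral_distribution _ _ _ _ _ P X')//.
by rewrite (@ge0_integral_distribution _ _ _ _ _ P Y').
Qed.

End independent_product.

Section past_independence.
Context {R : realType} d (T : measurableType d) (P : probability T R).
Variable xi : nat -> T -> R.
Hypothesis mxi : forall i, measurable_fun setT (xi i).
Hypothesis indep : forall n, mutually_independent P (fun i : 'I_n => xi i).

(** A pi-system generating the sigma-algebra of the first [n] variables; an unconstrained coordinate
    has [U i = setT]. *)
Definition past_cylinders n : set (set T) :=
  [set A | exists2 U : nat -> set R, (forall i, measurable (U i)) &
    A = \bigcap_(i in `I_n) (xi i @^-1` U i)].

Lemma bigcap_ord n (F : nat -> set T) :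
  \bigcap_(i in [set` [set: 'I_n]%SET]) F i = \bigcap_(i in `I_n) F i.
Proof.
apply/seteqP; split => w Fw i /=.
  by move=> i_n; apply: (Fw (Ordinal i_n)); rewrite /= inE.
by move=> _; exact: (Fw i (ltn_ord i)).
Qed.

Lemma past_cylinders_measurable n A : past_cylinders n A -> measurable A.
Proof.
move=> [U mU ->]; apply: bigcap_measurableType => i _.
by rewrite -[X in measurable X]setTI; exact: mxi.
Qed.

Lemma past_cylinders_prob n (U : nat -> set R) : (forall i, measurable (U i)) ->
  P (\bigcap_(i in `I_n) (xi i @^-1` U i)) =
  (\prod_(i < n) P (xi i @^-1` U i))%E.
Proof.
move=> mU; rewrite -bigcap_ord (indep (n := n) _ (U := fun i => U i))//.
by apply: eq_bigl => i; rewrite inE.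
Qed.

(** Dynkin's pi-lambda argument. Measurability in [T] is carried through the induction because the
    complement and union cases compute with [P]. *)
Lemma past_independence n A V : <<s past_cylinders n >> A -> measurable V ->
  measurable A /\ (P (A `&` xi n @^-1` V) = P A * P (xi n @^-1` V))%E.
Proof.
move=> + mV; set E := xi n @^-1` V.
have mE : measurable E by rewrite -[X in measurable X]setTI; exact: mxi.
move: A; apply: (@dynkin_induction _ (g_sigma_algebraType (past_cylinders n)) _
  (fun A => d.-measurable A /\ (P (A `&` E) = P A * P E)%E)) => //.
- move=> _ _ [U mU ->] [V' mV' ->]; exists (fun i => U i `&` V' i).
    by move=> i; exact: measurableI.
  by rewrite bigcapI.
- by split => //; rewrite setTI probability_setT mul1e.
- move=> A cA; split; first exact: past_cylinders_measurable cA.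
  (* With [V] as the constraint at index [n], the intersection becomes a cylinder over [n.+1]
     variables. *)
  case: cA => U mU ->; pose U' i := if (i < n)%N then U i else V.
  have mU' i : measurable (U' i) by rewrite /U'; case: ifP.
  have -> : \bigcap_(i in `I_n) (xi i @^-1` U i) `&` E =
      \bigcap_(i in `I_n.+1) (xi i @^-1` U' i).
    apply/seteqP; split => [w [Uw Ew] i /=|w Uw].
      rewrite ltnS leq_eqVlt => /predU1P[->|i_n]; rewrite /U' ?ltnn ?i_n//.
      exact: Uw.
    split; last by have := Uw n (ltnSn n); rewrite /U' ltnn.
    by move=> i /= i_n; have := Uw i (ltnW i_n); rewrite /U' i_n.
  rewrite !past_cylinders_prob// big_ord_recr/= /U' ltnn; congr (_ * _)%E.
  by apply: eq_bigr => i _; rewrite ltn_ord.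
- move=> A _ [mA PA]; split; first exact: measurableC.
  rewrite setIC -setDE measureD//; last by rewrite ltey_eq fin_num_measure.
  rewrite probability_setC// muleBl ?mul1e ?fin_num_measure//.
    by congr (_ - _)%E; rewrite setIC; exact: PA.
- move=> F _ tF FP.
  have mF i : d.-measurable (F i) := (FP i).1.
  split; first exact: bigcup_measurable.
  rewrite setI_bigcupl !measure_bigcup//; last 2 first.
  - by move=> i _; exact: measurableI.
  - exact: trivIset_setIr.
  rewrite -(fineK (fin_num_measure P E mE)) muleC -nneseriesZl//=.
  by apply: eq_eseriesr => i _; rewrite (FP i).2 muleC fineK// fin_num_measure.
Qed.

End past_independence.

(** * Optional stopping for random walks *)

Section stopped_walk.
Context {R : realType}.
Variables (p lo hi delta : R).

(* Position and elapsed time of the walk with increments [x] and time step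
   [delta], frozen as soon as it leaves ]lo, hi[. *)
Fixpoint stopped_walk (x : nat -> R) (n : nat) : R * R :=
  if n is m.+1 then
    let: (z, s) := stopped_walk x m in
    if lo < z < hi then (z + x m, s + delta) else (z, s)
  else (p, 0).

(** Only the first [n] increments enter and [X] is arbitrary, so that [integral_stopped_walk] can
    also apply it to the sigma-algebra of the past. *)
Lemma measurable_stopped_walk d (X : measurableType d) (xi : nat -> X -> R) n :
  (forall i, (i < n)%N -> measurable_fun setT (xi i)) ->
  measurable_fun setT (fun w => stopped_walk (xi^~ w) n).
Proof.
elim: n => [|n IH] mxi //=.
have {}IH := IH (fun i i_n => mxi i (ltnW i_n)).
have mz : measurable_fun setT (fun w => (stopped_walk (xi^~ w) n).1).
  exact: measurableT_comp.
have ms : measurable_fun setT (fun w => (stopped_walk (xi^~ w) n).2).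
  exact: measurableT_comp.
have -> : (fun w => let: (z, s) := stopped_walk (xi^~ w) n in
    if lo < z < hi then (z + xi n w, s + delta) else (z, s)) =
  (fun w => if lo < (stopped_walk (xi^~ w) n).1 < hi then
     ((stopped_walk (xi^~ w) n).1 + xi n w, (stopped_walk (xi^~ w) n).2 + delta)
     else stopped_walk (xi^~ w) n).
  by apply/funext => w; case: stopped_walk.
apply: measurable_fun_ifT => //.
  by apply: measurable_and; apply: measurable_fun_ltr.
apply/measurable_fun_pairP; split; apply: measurable_funD => //.
exact: mxi.
Qed.

Lemma stopped_walk_stop x n : ~~ (lo < (stopped_walk x n).1 < hi) ->
  stopped_walk x n.+1 = stopped_walk x n.
Proof. by rewrite /=; case: stopped_walk => z s /= /negbTE ->. Qed.

Lemma stopped_walk_move x n : lo < (stopped_walk x n).1 < hi ->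
  stopped_walk x n.+1 =
  ((stopped_walk x n).1 + x n, (stopped_walk x n).2 + delta).
Proof. by rewrite /=; case: stopped_walk => z s /= ->. Qed.

Lemma stopped_walk_time_le x n : 0 <= delta ->
  (stopped_walk x n).2 <= n%:R * delta.
Proof.
move=> delta0; elim: n => [|n IH]; first by rewrite mul0r.
have [inI|ninI] := boolP (lo < (stopped_walk x n).1 < hi).
  by rewrite stopped_walk_move//= -natr1 mulrDl mul1r lerD2r.
by rewrite stopped_walk_stop// (le_trans IH)// ler_wpM2r// ler_nat.
Qed.

End stopped_walk.

Section stopped_martingale.
Context {R : realType} d (T : measurableType d) (P : probability T R).
Variables (xi : nat -> T -> R) (delta t : R).
Hypothesis mxi : forall i, measurable_fun setT (xi i).
Hypothesis indep : forall n, mutually_independent P (fun i : 'I_n => xi i).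
Hypothesis xi_laplace : forall i,
  (\int[P]_w (expR (t * xi i w))%:E = (expR (t ^+ 2 / 2 * delta))%:E)%E.

(** While the walk moves, a step multiplies the exponential by exp (t xi - t^2 delta / 2), which is
    independent of the past and has mean 1; once frozen, nothing changes. *)
Lemma integral_stopped_walk (p lo hi : R) n :
  (\int[P]_w (expR (t * (stopped_walk p lo hi delta (xi^~ w) n).1 -
    t ^+ 2 / 2 * (stopped_walk p lo hi delta (xi^~ w) n).2))%:E =
   (expR (t * p))%:E)%E.
Proof.
pose W w n := stopped_walk p lo hi delta (xi^~ w) n.
pose M z := expR (t * z.1 - t ^+ 2 / 2 * z.2).
rewrite -[LHS]/(\int[P]_w (M (W w n))%:E)%E.
have mM : measurable_fun setT M.
  apply: measurableT_comp => //.
  by apply: measurable_funB; apply: measurable_funM.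
have mW m : measurable_fun setT (fun w => W w m).
  exact: measurable_stopped_walk.
elim: n => [|n IH].
  under eq_integral do rewrite /M /= mulr0 subr0.
  rewrite integral_cst// -[RHS]mule1; congr (_ * _)%E.
  exact: probability_setT.
pose A := [set z : R * R | lo < z.1 < hi].
have mA : measurable A.
  have mb : measurable_fun setT (fun z : R * R => lo < z.1 < hi).
    by apply: measurable_and; apply: measurable_fun_ltr.
  by have := mb measurableT [set true] I; rewrite setTI.
(* [a] is the part still moving, [b] the part already frozen. *)
pose a z := M z * \1_A z; pose b z := M z * \1_(~` A) z.
have ma : measurable_fun setT a by apply: measurable_funM => //;
  exact: measurable_indic.
have mb : measurable_fun setT b.
  by apply: measurable_funM => //; apply: measurable_indic; exact: measurableC.
have maW : measurable_fun setT (fun w => a (W w n)) by exact: measurableT_comp.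
have mbW : measurable_fun setT (fun w => b (W w n)) by exact: measurableT_comp.
have mE : measurable_fun setT (fun x : R => expR (t * x - t ^+ 2 / 2 * delta)).
  by apply: measurableT_comp => //; apply: measurable_funB => //;
    apply: measurable_funM.
have a0 z : 0 <= a z by rewrite mulr_ge0 ?expR_ge0.
have b0 z : 0 <= b z by rewrite mulr_ge0 ?expR_ge0.
have ab z : M z = a z + b z.
  rewrite /a /b !indicE in_setC.
  by case: (z \in A); rewrite /= mulr1 mulr0 ?addr0 ?add0r.
have step w : M (W w n.+1) =
    a (W w n) * expR (t * xi n w - t ^+ 2 / 2 * delta) + b (W w n).
  have [inA|ninA] := boolP (lo < (W w n).1 < hi).
    rewrite /a /b !indicE mem_set// memNset; last by apply.
    rewrite mulr1 mulr0 addr0 /W stopped_walk_move// /M -expRD;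
      congr expR => /=.
    by ring.
  rewrite /a /b !indicE memNset; last exact/negP.
  rewrite mem_set; last exact/negP.
  by rewrite mulr0 mul0r add0r mulr1 /W stopped_walk_stop.
under eq_integral do rewrite step EFinD.
rewrite ge0_integralD//; last 4 first.
- by move=> w _; rewrite lee_fin mulr_ge0 ?expR_ge0.
- apply/measurable_EFinP; apply: measurable_funM => //.
  exact: (measurableT_comp mE (mxi n)).
- by move=> w _; rewrite lee_fin.
- exact/measurable_EFinP.
have -> : (\int[P]_w (a (W w n) * expR (t * xi n w - t ^+ 2 / 2 * delta))%:E =
    \int[P]_w (a (W w n))%:E)%E.
  under eq_integral do rewrite EFinM.
  have mgf1 : (\int[P]_w (expR (t * xi n w - t ^+ 2 / 2 * delta))%:E = 1)%E.
    under eq_integral do rewrite expRD EFinM.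
    rewrite ge0_integralZr//; last first.
      apply/measurable_EFinP; apply: measurableT_comp => //.
      exact: measurable_funM.
    by rewrite xi_laplace -EFinM -expRD subrr expR0.
  (* The absolute value supplies a function nonnegative on the whole line; on the values of [a] it
     is the identity. *)
  have ind := @ge0_integral_independent _ _ _ P (fun w => a (W w n)) (xi n)
    (fun x => `|x|%:E)
    (fun x => (expR (t * x - t ^+ 2 / 2 * delta))%:E).
  rewrite (_ : (fun w => _) = (fun w => `|a (W w n)|%:E *
      (expR (t * xi n w - t ^+ 2 / 2 * delta))%:E)%E); last first.
    by apply/funext => w; rewrite ger0_norm.
  rewrite ind ?mgf1 ?mule1//.
  - by apply: eq_integral => w _; rewrite ger0_norm.
  - move=> U V mU mV.
    have [] // := @past_independence _ _ _ P xi mxi indep n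
      ((fun w => a (W w n)) @^-1` U) V.
    (* The same points under the sigma-algebra of the first [n] increments: measurability there puts
       the preimage among the past events. *)
    pose X := g_sigma_algebraType (past_cylinders xi n).
    have mxi' i : (i < n)%N -> measurable_fun setT (xi i : X -> R).
      move=> i_n _ V' mV'; rewrite setTI; apply: sub_sigma_algebra.
      exists (fun j => if j == i then V' else setT).
        by move=> j; case: ifP.
      apply/seteqP; split => [w V'w j /= _|w /(_ i i_n)];
        last by rewrite /= eqxx.
      by case: eqP => // ->.
    have := @measurable_stopped_walk _ p lo hi delta _ X _ n mxi'.
    move=> /(measurableT_comp ma)/(_ measurableT _ mU).
    by rewrite setTI.
  - by apply/measurable_EFinP; exact: normr_measurable.
  - by apply/measurable_EFinP; exact: mE.
rewrite -ge0_integralD//; last 4 first.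
- by move=> w _; rewrite lee_fin.
- exact/measurable_EFinP.
- by move=> w _; rewrite lee_fin.
- exact/measurable_EFinP.
by rewrite -IH; apply: eq_integral => w _; rewrite ab.
Qed.
End stopped_martingale.

(** * Exit of a continuous path observed on dyadic grids *)

Section stopped_path.
Context {R : realType}.
Variable b : R -> R.
Hypothesis cb : {within `[0, +oo[, continuous b}.

Lemma path_seq_cvg (u : nat -> R) (l : R) : (forall n, 0 <= u n) -> 0 <= l ->
  u @ \oo --> l -> b \o u @ \oo --> b l.
Proof.
move=> u0 l0 ul; have l_in : `[0, +oo[%classic l by rewrite /= in_itv/= l0.
have /subspace_continuousP/(_ l l_in) bl := cb.
apply: (cvg_comp _ _ _ bl) => B /= [e e0 Be].
have : \forall n \near \oo, `|l - u n| < e by move/cvgrPdist_lt : ul; apply.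
apply: filterS => n ln; apply: Be => //=.
by rewrite in_itv/= u0.
Qed.

Definition path_increments (delta : R) (i : nat) : R :=
  b (i.+1%:R * delta) - b (i%:R * delta).

Definition path_walk lo hi delta :=
  stopped_walk (b 0) lo hi delta (path_increments delta).

(** The increments telescope, and [i] is the smaller of [n] and the first grid index at which the
    path is outside the window. *)
Lemma path_walkP lo hi delta n : exists2 i, (i <= n)%N &
  [/\ path_walk lo hi delta n = (b (i%:R * delta), i%:R * delta),
      (forall j, (j < i)%N -> lo < b (j%:R * delta) < hi) &
      ((i < n)%N -> ~~ (lo < b (i%:R * delta) < hi))].
Proof.
elim: n => [|n [i i_n [Wn before after]]].
  by exists 0%N => //; split; rewrite // /path_walk/= mul0r.
have [inI|ninI] := boolP (lo < b (i%:R * delta) < hi).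
  have E : i = n.
    apply/eqP; rewrite eqn_leq i_n /= leqNgt; apply/negP => /after.
    by rewrite inI.
  exists n.+1 => //; split.
  - rewrite /path_walk stopped_walk_move -/(path_walk _ _ _) Wn /= E;
    last by rewrite -E.
    by rewrite /path_increments addrC subrK -natr1 mulrDl mul1r.
  - move=> j; rewrite ltnS leq_eqVlt => /predU1P[->|jn]; first by rewrite -E.
    by apply: before; rewrite E.
  - by rewrite ltnn.
exists i; first exact: leqW.
by split => //; rewrite /path_walk stopped_walk_stop -/(path_walk _ _ _) Wn.
Qed.

Section fixed_window.
Variables (lo hi : R) (N : nat).

Let step m : R := (2 ^+ m)^-1.

Let step_gt0 m : 0 < step m. Proof. by rewrite invr_gt0 exprn_gt0. Qed.

Let stepS m i : i%:R * step m = (i.*2)%:R * step m.+1.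
Proof. by rewrite /step exprS invfM -muln2 natrM mulrA mulfK. Qed.

Definition dyadic_walk m := path_walk lo hi (step m) (N * 2 ^ m).

Lemma dyadic_walk_time_ge0 m : 0 <= (dyadic_walk m).2.
Proof.
rewrite /dyadic_walk; have [i _ [-> _ _]] :=
  path_walkP lo hi (step m) (N * 2 ^ m).
by rewrite mulr_ge0// ltW.
Qed.

(** The finer grid contains the coarser one, so it detects an exit no later. *)
Lemma dyadic_walk_timeS m : (dyadic_walk m.+1).2 <= (dyadic_walk m).2.
Proof.
rewrite /dyadic_walk.
have [i iN [-> _ i_stop]] := path_walkP lo hi (step m) (N * 2 ^ m).
have [j jN [-> j_before _]] := path_walkP lo hi (step m.+1) (N * 2 ^ m.+1).
rewrite /= (stepS m i) ler_pM2r ?step_gt0// ler_nat leqNgt; apply/negP => ij.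
have := j_before _ ij; rewrite -stepS => inI.
have iNE : i = (N * 2 ^ m)%N.
  apply/eqP; rewrite eqn_leq iN /= leqNgt; apply/negP => /i_stop.
  by rewrite inI.
by move: ij; rewrite ltnNge iNE -muln2 -mulnA -expnSr jN.
Qed.

Lemma dyadic_walk_pos m : (dyadic_walk m).1 = b (dyadic_walk m).2.
Proof.
rewrite /dyadic_walk.
by have [i iN [-> _ _]] := path_walkP lo hi (step m) (N * 2 ^ m).
Qed.

Lemma dyadic_walk_time_le m : (dyadic_walk m).2 <= N%:R.
Proof.
rewrite /dyadic_walk.
have [i iN [-> _ _]] := path_walkP lo hi (step m) (N * 2 ^ m).
by rewrite /= ler_pdivrMr ?exprn_gt0// -natrX -natrM ler_nat.
Qed.

Lemma dyadic_walk_stopped m : (dyadic_walk m).2 < N%:R ->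
  ~~ (lo < b (dyadic_walk m).2 < hi).
Proof.
rewrite /dyadic_walk.
have [i iN [-> _ stop]] := path_walkP lo hi (step m) (N * 2 ^ m).
rewrite /= ltr_pdivrMr ?exprn_gt0// -natrX -natrM ltr_nat; exact: stop.
Qed.

(** [t'] is the last grid point not after [t]. *)
Lemma dyadic_walk_before m t : 0 <= t -> t < (dyadic_walk m).2 ->
  exists2 t', 0 <= t' <= t & t - t' < step m /\ lo < b t' < hi.
Proof.
move=> t0; rewrite /dyadic_walk.
have [i iN [-> before _]] := path_walkP lo hi (step m) (N * 2 ^ m) => /= ti.
pose k := Num.truncn (t / step m).
have /truncn_itv := divr_ge0 t0 (ltW (step_gt0 m)); rewrite -/k => /andP[kt tk].
move: kt tk; rewrite ler_pdivlMr// ltr_pdivrMr// => kt tk.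
exists (k%:R * step m).
  by rewrite kt mulr_ge0// ltW.
split; first by move: tk; rewrite -natr1; lra.
apply: before; rewrite -(ltr_nat R) -(ltr_pM2r (step_gt0 m)).
exact: le_lt_trans ti.
Qed.

Lemma step_cvg0 : step @ \oo --> 0.
Proof.
rewrite /step; under eq_fun do rewrite -exprVn.
by apply: cvg_expr; rewrite ger0_norm ?invr_ge0//; lra.
Qed.

(** The stopping times decrease to [s]. Before [s] the path is a limit of grid values inside the
    window, which only gives weak inequalities. If [b s] were inside the open window with [s < N],
    continuity would put the walk inside at its stopping time for large [m]. *)
Lemma dyadic_walk_cvg : 0 <= b 0 <= 1 -> 0 <= lo -> hi <= 1 ->
  exists s, [/\ (dyadic_walk m).2 @[m --> \oo] --> s,
    (dyadic_walk m).1 @[m --> \oo] --> b s,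
    0 <= s <= N%:R, (s < N%:R -> ~~ (lo < b s < hi)) &
    (forall t, 0 <= t < s -> lo <= b t <= hi) /\ 0 <= b s <= 1].
Proof.
move=> b01 lo0 hi1.
pose tau m := (dyadic_walk m).2.
have dec : nonincreasing_seq tau.
  by apply/nonincreasing_seqP => m; exact: dyadic_walk_timeS.
have lb : has_lbound (range tau).
  by exists 0 => _ [m _ <-]; exact: dyadic_walk_time_ge0.
have cvg_tau := nonincreasing_is_cvgn dec lb.
pose s := limn tau; have tau_s : tau @ \oo --> s by exact: cvg_tau.
have s_tau m : s <= tau m by exact: nonincreasing_cvgn_ge.
have s0 : 0 <= s.
  by apply: limr_ge => //; apply: nearW => m; exact: dyadic_walk_time_ge0.
have b_tau : b \o tau @ \oo --> b s.
  by apply: path_seq_cvg => // m; exact: dyadic_walk_time_ge0.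
have before t : 0 <= t < s -> lo <= b t <= hi.
  move=> /andP[t0 ts].
  have /choice[u hu] m : exists um, [/\ 0 <= um, um <= t, t - um < step m &
      lo < b um < hi].
    have [t' /andP[t'0 t't] [h1 h2]] :=
      dyadic_walk_before t0 (lt_le_trans ts (s_tau m)).
    by exists t'.
  have ut : u @ \oo --> t.
    apply/cvgrPdist_lt => e e0.
    have := step_cvg0 => /cvgrPdist_lt/(_ e e0); apply: filterS => m.
    have [h1 h2 h3 h4] := hu m.
    by rewrite sub0r normrN !ger0_norm ?subr_ge0// 1?ltW//; exact: lt_trans.
  have bu : b \o u @ \oo --> b t.
    by apply: path_seq_cvg => // m; have [] := hu m.
  rewrite -(cvg_lim _ bu)//; apply/andP; split.
    apply: limr_ge; first by apply/cvg_ex; exists (b t).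
    by apply: nearW => m /=; have [_ _ _ /andP[/ltW]] := hu m.
  apply: limr_le; first by apply/cvg_ex; exists (b t).
  by apply: nearW => m /=; have [_ _ _ /andP[_ /ltW]] := hu m.
exists s; split => //.
- by under eq_fun do rewrite dyadic_walk_pos.
- rewrite s0/=; apply: limr_le => //; apply: nearW => m;
  exact: dyadic_walk_time_le.
- move=> sN; apply/negP => /andP[lobs bshi].
  near \oo => m.
  have : tau m < N%:R.
    near: m; apply: (cvgr_lt s tau_s); exact: sN.
  move=> /dyadic_walk_stopped/negP; apply; apply/andP; split; near: m.
    exact: (cvgr_gt (b s) b_tau).
  exact: (cvgr_lt (b s) b_tau).
(* For [s = 0] the starting point may lie outside the window, so only the bounds 0 and 1 are
   available. For [s > 0] they pass to [b s] along times increasing to [s]. *)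
- split => //; have [s_gt0|s_le0] := ltP 0 s; last first.
    by have -> : s = 0 by apply/le_anti; rewrite s0 s_le0.
  pose u n : R := s * (1 - n.+1%:R^-1).
  have u_s n : 0 <= u n < s.
    have h1 : 0 < (n.+1%:R : R)^-1 by rewrite invr_gt0.
    have h2 : (n.+1%:R : R)^-1 <= 1 by rewrite invf_le1// ler1n.
    rewrite /u mulr_ge0 ?(ltW s_gt0)//= ?subr_ge0//.
    by rewrite gtr_pMr//; lra.
  have us : u @ \oo --> s.
    rewrite -[X in _ --> X]mulr1; apply: cvgM; first exact: cvg_cst.
    rewrite -[X in _ --> X]subr0; apply: cvgB; first exact: cvg_cst.
    exact: cvg_harmonic.
  have bu : b \o u @ \oo --> b s.
    by apply: path_seq_cvg => // n; have /andP[] := u_s n.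
  have Hu n : 0 <= b (u n) <= 1.
    have /andP[h1 h2] := before _ (u_s n).
    by rewrite (le_trans lo0)//= (le_trans h2).
  rewrite -(cvg_lim _ bu)//; apply/andP; split.
    apply: limr_ge; first by apply/cvg_ex; exists (b s).
    by apply: nearW => n /=; have /andP[] := Hu n.
  apply: limr_le; first by apply/cvg_ex; exists (b s).
  by apply: nearW => n /=; have /andP[] := Hu n.
Unshelve. all: by end_near. Qed.

End fixed_window.
End stopped_path.

Section exit_limit.
Context {R : realType}.
Implicit Types t : R.

(** The condition on [t] matters at [s = +oo]: for [t = 0] the transform is 1 at every finite time
    and 0 at infinity. *)
Lemma laplace_cvg t (u : nat -> R) (s : \bar R) : t != 0 -> (0 <= s)%E ->
  (u n)%:E @[n --> \oo] --> s ->
  laplace t (u n)%:E @[n --> \oo] --> laplace t s.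
Proof.
move=> t0; case: s => [r| |]// _ us /=.
  apply: continuous_cvg; first exact: continuous_expR.
  apply: (@cvgN _ R^o); apply: cvgM; first exact: cvg_cst.
  exact: (fine_cvg us).
have uy : u n @[n --> \oo] --> +oo by exact/cvgeryP.
apply: (@cvg_comp _ _ _ (fun n => t ^+ 2 / 2 * u n) (fun x => expR (- x))
  _ _ _ _ (@cvgr_expR R)).
have c0 : 0 < t ^+ 2 / 2 by rewrite divr_gt0// exprn_even_gt0.
apply/cvgryPge => A; move/cvgryPge : uy => /(_ (A / (t ^+ 2 / 2))).
by apply: filterS => n; rewrite ler_pdivrMr// mulrC.
Qed.

Lemma continuous_cosh : continuous (@cosh R).
Proof.
move=> x; apply: cvgM; last exact: cvg_cst.
apply: cvgD; first exact: continuous_expR.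
apply: continuous_cvg; first exact: continuous_expR.
exact: (@cvgN _ R^o).
Qed.

Section path.
Variable b : R -> R.
Hypothesis cb : {within `[0, +oo[, continuous b}.

Definition path_exit : \bar R :=
  ereal_inf [set t%:E | t in [set t : R | 0 <= t /\ ~ (0 < b t < 1)]].

Variables (eps s : nat -> R).
Hypothesis eps_gt0 : forall j, 0 < eps j.
Hypothesis eps_cvg0 : eps @ \oo --> 0.
Hypothesis s_bnd : forall j, 0 <= s j <= j%:R.
Hypothesis s_stop : forall j, s j < j%:R -> ~~ (eps j < b (s j) < 1 - eps j).
Hypothesis s_before : forall j t, 0 <= t < s j -> eps j <= b t <= 1 - eps j.
Hypothesis s_pos : forall j, 0 <= b (s j) <= 1.

Lemma s_le_exit j : ((s j)%:E <= path_exit)%E.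
Proof.
apply: le_ereal_inf_tmp => _ [t [t0 bt] <-]; rewrite lee_fin leNgt;
  apply/negP => ts.
have := @s_before j t; rewrite t0 ts => /(_ isT) /andP[h1 h2]; apply: bt.
by have := eps_gt0 j; lra.
Qed.

(** On the compact [0, t] the path keeps a positive distance from 0 and 1. Once [eps j] is below
    that distance and [j > t], neither the window nor the horizon can stop it before [t]. *)
Lemma exit_le_s t : 0 <= t -> (t%:E < path_exit)%E -> \forall j \near \oo,
  t <= s j.
Proof.
move=> t0 t_exit.
have inside u : 0 <= u <= t -> 0 < b u < 1.
  move=> /andP[u0 ut]; apply/negPn/negP => bu.
  have : (path_exit <= u%:E)%E.
    by apply: ereal_inf_lbound; exists u => //; split => //; exact/negP.
  by move=> /(lt_le_trans t_exit); rewrite lte_fin ltNge ut.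
have cbt : {within `[0, t], continuous b}.
  by apply: continuous_subspaceW cb => x /=; rewrite !in_itv/= => /andP[->].
have [c1 c1t minb] := EVT_min t0 cbt.
have [c2 c2t maxb] := EVT_max t0 cbt.
have := inside c1; rewrite in_itv/= in c1t; move=> /(_ c1t)/andP[c1_0 _].
have := inside c2; rewrite in_itv/= in c2t; move=> /(_ c2t)/andP[_ c2_1].
near=> j.
rewrite leNgt; apply/negP => st.
have s0 : 0 <= s j by have /andP[] := s_bnd j.
have sj : s j < j%:R.
  by apply: lt_trans st _; near: j; exact: nbhs_infty_gtr.
have /negP := s_stop sj; apply.
have := minb (s j); have := maxb (s j);
  rewrite in_itv/= s0 (ltW st) => /(_ isT) h2 /(_ isT) h1.
have e1 : eps j < b c1 by near: j; exact: (cvgr_lt 0).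
have e2 : eps j < 1 - b c2 by near: j; apply: (cvgr_lt 0) => //; lra.
by lra.
Unshelve. all: by end_near. Qed.

Lemma path_exit_ge0 : (0 <= path_exit)%E.
Proof. by apply: le_ereal_inf_tmp => _ [t [t0 bt] <-]; rewrite lee_fin. Qed.

Lemma s_cvg_exit : (s j)%:E @[j --> \oo] --> path_exit.
Proof.
have := path_exit_ge0; case E : path_exit => [r| |]// r0.
  apply: cvg_EFin; first by apply: nearW.
  apply/cvgrPdist_le => e e0.
  have near_s : \forall j \near \oo, r - e <= s j.
    have [re|re] := leP 0 (r - e).
      by apply: exit_le_s => //; rewrite E lte_fin; lra.
    by apply: nearW => j; have /andP[] := s_bnd j; lra.
  apply: filterS near_s => j re; have := s_le_exit j; rewrite E lee_fin => sr.
  by rewrite /= ger0_norm ?subr_ge0// lerBlDr -lerBlDl.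
apply/cvgeyPge => A; near=> j; rewrite lee_fin (@le_trans _ _ (Num.max A 0))//.
  by rewrite le_max lexx.
near: j; apply: exit_le_s; last by rewrite E ltry.
by rewrite le_max lexx orbT.
Unshelve. all: by end_near. Qed.

(** If the exit time is finite, eventually [s j < j], so the window has been left and [b (s j)] is
    within [eps j] of 0 or 1; evenness of cosh removes the choice of endpoint. If it is infinite,
    the Laplace factor vanishes in the limit and the other factor is bounded. *)
Lemma laplace_cosh_cvg_exit t : t != 0 ->
  laplace t (s j)%:E * cosh (t * (b (s j) - 2^-1)) @[j --> \oo] -->
  laplace t path_exit * cosh (t / 2).
Proof.
move=> t0.
have lap := laplace_cvg t0 path_exit_ge0 s_cvg_exit.
case E : path_exit => [r| |].
- rewrite -E; apply: cvgM => //.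
  have normE j : cosh (t * (b (s j) - 2^-1)) = cosh (t * `|b (s j) - 2^-1|).
    have [h|h] := leP 0 (b (s j) - 2^-1); first by rewrite ger0_norm.
    by rewrite ltr0_norm// mulrN cosh_even.
  under eq_fun do rewrite normE.
  apply: continuous_cvg; first exact: continuous_cosh.
  apply: cvgM; first exact: cvg_cst.
  apply/cvgrPdist_le => e e0; near=> j.
  have sj : s j < j%:R.
    apply: le_lt_trans (_ : r < _);
      first by have := s_le_exit j; rewrite E lee_fin.
    by near: j; exact: nbhs_infty_gtr.
  have := s_stop sj; rewrite negb_and -!leNgt => st.
  have := s_pos j; have ej : eps j <= e by apply: ltW; near: j;
    exact: (cvgr_lt 0).
  move=> /andP[b0 b1]; rewrite ler_norml; have ej0 := eps_gt0 j.
  have [h|h] := leP 0 (b (s j) - 2^-1).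
    by rewrite ger0_norm//; case/orP: st => st; lra.
  by rewrite ltr0_norm//; case/orP: st => st; lra.
- rewrite E in lap; rewrite /= mul0r.
  apply: (@squeeze_cvgr _ _ _ _ (fun=> 0) (fun j => laplace t (s j)%:E *
    cosh (t / 2))).
  + near=> j; rewrite mulr_ge0 ?laplace_ge0 ?(ltW (cosh_gt0 _))//=.
    rewrite ler_wpM2l ?laplace_ge0//.
    by apply: cosh_unit_interval.
  + exact: cvg_cst.
  + rewrite -[X in _ --> X](mul0r (cosh (t / 2))).
    by apply: cvgM; [exact: lap|exact: cvg_cst].
- by have := path_exit_ge0; rewrite E.
Unshelve. all: by end_near. Qed.

End path.
End exit_limit.

(** * Limits under the expectation *)

Lemma bounded_cvg_integral {R : realType} d (T : measurableType d)
    (P : probability T R) (Y_ : nat -> T -> R) (Y : T -> R) (K : R) :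
  (forall m, measurable_fun setT (Y_ m)) -> measurable_fun setT Y ->
  {ae P, forall w, Y_ m w @[m --> \oo] --> Y w} ->
  {ae P, forall w, forall m, `|Y_ m w| <= K} ->
  (\int[P]_w (Y_ m w)%:E)%E @[m --> \oo] --> (\int[P]_w (Y w)%:E)%E.
Proof.
move=> mY_ mY Y_Y YK.
have h1 m : measurable_fun setT (fun w => (Y_ m w)%:E)
  by exact/measurable_EFinP.
have h2 : measurable_fun setT (fun w => (Y w)%:E) by exact/measurable_EFinP.
have h3 : {ae P, forall w, setT w -> (Y_ m w)%:E @[m --> \oo] --> (Y w)%:E}.
  by apply: filterS Y_Y => w Yw _; apply: cvg_EFin; [exact: nearW|exact: Yw].
have h4 : P.-integrable setT (EFin \o cst K)
  by exact: finite_measure_integrable_cst.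
have h5 : {ae P, forall w n, setT w -> `|(Y_ n w)%:E| <= (EFin \o cst K) w}%E.
  by apply: filterS YK => w Yw m _; rewrite /= lee_fin.
by have [_ _] := dominated_convergence measurableT h1 h2 h3 h4 h5.
Qed.

Section square_bounded_convergence.
Context {R : realType} d (T : measurableType d) (P : probability T R).
Variables (Y_ : nat -> T -> R) (Y : T -> R).
Hypothesis mY_ : forall m, measurable_fun setT (Y_ m).
Hypothesis mY : measurable_fun setT Y.
Hypothesis Y_Y : {ae P, forall w, Y_ m w @[m --> \oo] --> Y w}.
Hypothesis Y_0 : forall m w, 0 <= Y_ m w.

(* Uniform integrability in the form of an L^2 bound. *)
Lemma square_bounded_cvg_integral (c C M : R) :
  {ae P, forall w, Y w <= M} ->
  (forall m, \int[P]_w (Y_ m w)%:E = c%:E)%E ->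
  (forall m, \int[P]_w (Y_ m w ^+ 2)%:E <= C%:E)%E ->
  (\int[P]_w (Y w)%:E = c%:E)%E.
Proof.
move=> YM Yc YC.
have key K : 0 < K -> M <= K ->
  (c%:E - (C / K)%:E <= \int[P]_w (Y w)%:E <= c%:E)%E.
  move=> K0 MK; pose m_ n w := Num.min (Y_ n w) K.
  have mm_ n : measurable_fun setT (m_ n) by exact: measurable_minr.
  have m0 n w : 0 <= m_ n w by rewrite le_min Y_0 ltW.
  have minY : (\int[P]_w (Y w)%:E = \int[P]_w (Num.min (Y w) K)%:E)%E.
    apply: ae_eq_integral => //.
    - exact/measurable_EFinP.
    - by apply/measurable_EFinP; exact: measurable_minr.
    - by apply: filterS YM => w Yw _; rewrite min_l// (le_trans Yw).
  have cvg_m : (\int[P]_w (m_ n w)%:E)%E @[n --> \oo] -->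
    (\int[P]_w (Y w)%:E)%E.
    rewrite minY; apply: (@bounded_cvg_integral _ _ _ _ _ _ K) => //.
    - exact: measurable_minr.
    - apply: filterS Y_Y => w Yw; under eq_fun do rewrite /m_ minr_absE.
      rewrite minr_absE; apply: cvgM; last exact: cvg_cst.
      apply: cvgB; first by apply: cvgD => //; exact: cvg_cst.
      by apply: cvg_norm; apply: cvgB => //; exact: cvg_cst.
    - by apply: aeW => w n; rewrite ger0_norm ?m0// ge_min lexx orbT.
  have bnd n : (c%:E - (C / K)%:E <= \int[P]_w (m_ n w)%:E <= c%:E)%E.
    apply/andP; split; last first.
      rewrite -(Yc n); apply: ge0_le_integral => //.
      - by move=> w _; rewrite lee_fin.
      - exact/measurable_EFinP.
      - exact/measurable_EFinP.
      - by move=> w _; rewrite lee_fin ge_min lexx.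
    rewrite leeBlDr// -(Yc n).
    have mY2 : measurable_fun setT (fun w => Y_ n w ^+ 2)
      by exact: measurable_funX.
    (* For y >= 0 one has y <= min (y, K) + y^2 / K, so truncation at [K] costs at most [C / K]. *)
    apply: (@le_trans _ _
      (\int[P]_w ((m_ n w)%:E + (K^-1 * Y_ n w ^+ 2)%:E))%E).
      apply: ge0_le_integral => //.
      - by move=> w _; rewrite lee_fin.
      - exact/measurable_EFinP.
      - apply: emeasurable_funD; apply/measurable_EFinP => //.
        exact: measurable_funM.
      - move=> w _; rewrite -EFinD lee_fin /m_.
        have Yw := Y_0 n w; have Yw2 : 0 <= K^-1 * Y_ n w ^+ 2.
          by rewrite mulr_ge0 ?sqr_ge0// invr_ge0 ltW.
        have [h|h] := leP (Y_ n w) K; first by rewrite lerDl.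
        rewrite -lerBlDl ler_pdivlMl//.
        by move: (Y_ n w) h Yw => y h y0; nra.
    rewrite ge0_integralD//; last 4 first.
    - by move=> w _; rewrite lee_fin.
    - exact/measurable_EFinP.
    - by move=> w _; rewrite lee_fin mulr_ge0 ?sqr_ge0// invr_ge0 ltW.
    - by apply/measurable_EFinP; exact: measurable_funM.
    rewrite leeD2l//; under eq_integral do rewrite EFinM.
    rewrite ge0_integralZl//; last 3 first.
    - exact/measurable_EFinP.
    - by move=> w _; rewrite lee_fin sqr_ge0.
    - by rewrite lee_fin invr_ge0 ltW.
    by rewrite mulrC EFinM lee_pmul2l// ?lte_fin ?invr_gt0//.
  apply/andP; split.
    by apply: cvge_ge cvg_m; apply: nearW => n; have /andP[] := bnd n.
  by apply: cvge_le cvg_m; apply: nearW => n; have /andP[] := bnd n.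
apply/eqP; rewrite eq_le; apply/andP; split.
  have M1 : 0 < Num.max M 1 by rewrite lt_max ltr01 orbT.
  have MM : M <= Num.max M 1 by rewrite le_max lexx.
  by have /andP[] := key _ M1 MM.
apply/lee_addgt0Pr => e e0.
(* The last entry makes [C / K <= e]. *)
pose K := Num.max (Num.max M 1) (`|C| / e).
have K0 : 0 < K by rewrite !lt_max ltr01 orbT.
have MK : M <= K by rewrite !le_max lexx.
have /andP[+ _] := key _ K0 MK.
rewrite leeBlDr// => h; apply: le_trans h _; rewrite leeD2l// lee_fin.
rewrite ler_pdivrMr// (le_trans (ler_norm _))// mulrC -ler_pdivrMr//.
by rewrite !le_max lexx orbT.
Qed.

End square_bounded_convergence.

(** * Laplace transform of the Brownian exit time *)

Section brownian_exit.
Context {R : realType} d (T : measurableType d) (P : probability T R).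
Variables (p : R) (B : R -> {RV P >-> R}).
Hypotheses (p01 : 0 <= p <= 1) (hB : brownian_motion p B).

Let step m : R := (2 ^+ m)^-1.
Let step_gt0 m : 0 < step m. Proof. by rewrite invr_gt0 exprn_gt0. Qed.

Let xi m (i : nat) (w : T) : R := B (i.+1%:R * step m) w - B (i%:R * step m) w.

Let mxi m i : measurable_fun setT (xi m i).
Proof. by apply: measurable_funB; exact: measurable_funPT. Qed.

Let xi_indep m n : mutually_independent P (fun i : 'I_n => xi m i).
Proof.
apply: (brownian_independent_increments hB (t := fun i => i%:R * step m)).
  by rewrite mul0r.
by apply/nondecreasing_seqP => i; rewrite ler_pM2r// ler_nat.
Qed.

Let xi_laplace m t i :
  (\int[P]_w (expR (t * xi m i w))%:E = (expR (t ^+ 2 / 2 * step m))%:E)%E.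
Proof.
have lt_i : i%:R * step m < i.+1%:R * step m by rewrite ltr_pM2r// ltr_nat.
have mx : measurable_fun setT (xi m i : T -> measurableTypeR R) by exact: mxi.
pose X : {RV P >-> measurableTypeR R} :=
  HB.pack (xi m i : T -> measurableTypeR R) (isMeasurableFun.Build _ _ _ _ _
    mx).
have mf : measurable_fun setT (fun x : measurableTypeR R => (expR (t * x))%:E :
  \bar R).
  by apply/measurable_EFinP; apply: measurableT_comp => //;
    exact: measurable_funM.
transitivity (\int[distribution P X]_x (expR (t * x))%:E)%E.
  by rewrite ge0_integral_distribution// => x; rewrite lee_fin expR_ge0.
transitivity (\int[normal_prob 0 (Num.sqrt (step m))]_x (expR (t * x))%:E)%E.
  apply: eq_measure_integral => U mU _.
  have := brownian_gaussian_increments hB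
    (mulr_ge0 (ler0n _ i) (ltW (step_gt0 m))) lt_i mU.
  by rewrite -mulrBl -natrB// subSnn mul1r.
rewrite normal_prob_laplace ?sqr_sqrtr ?(ltW (step_gt0 m))//; last first.
  by rewrite gt_eqF// sqrtr_gt0.
by rewrite mulrAC.
Qed.

Let eps j : R := (j.+2%:R)^-1.

(** One index [j] drives both the window ]eps j, 1 - eps j[, which grows to ]0, 1[, and the time
    horizon [j]. *)
Let Z j m w :=
  stopped_walk p (eps j) (1 - eps j) (step m) ((xi m)^~ w) (j * 2 ^ m).

Let mZ j m : measurable_fun setT (Z j m).
Proof. by apply: measurable_stopped_walk => i _; exact: mxi. Qed.

Let expZ t j m :
  (\int[P]_w (expR (t * (Z j m w).1 - t ^+ 2 / 2 * (Z j m w).2))%:E =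
    (expR (t * p))%:E)%E.
Proof.
exact: (integral_stopped_walk (mxi m) (xi_indep m) (xi_laplace m t)).
Qed.

(* Upper limits are measurable on the whole space; they are limits only for
   the paths in [good]. *)
Let pos j w : R := fine (limn_esup (fun m => (Z j m w).1%:E)).
Let time j w : R := fine (limn_esup (fun m => (Z j m w).2%:E)).

Let mpos j : measurable_fun setT (pos j).
Proof.
apply: measurableT_comp => //; apply: measurable_fun_limn_esup => m.
by apply/measurable_EFinP; exact: measurableT_comp.
Qed.

Let mtime j : measurable_fun setT (time j).
Proof.
apply: measurableT_comp => //; apply: measurable_fun_limn_esup => m.
by apply/measurable_EFinP; exact: measurableT_comp.
Qed.

Let good w :=
  B 0 w = p /\ {within `[0, +oo[, continuous (fun t : R => B t w : R)}.

Let ae_good : {ae P, forall w, good w}.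
Proof.
have := brownian_start hB; have := brownian_continuous_paths hB.
by apply: filterS2 => w.
Qed.

Let eps_gt0 j : 0 < eps j. Proof. by rewrite invr_gt0. Qed.

Let goodP w j : good w -> let b := (fun t => B t w : R) in
  [/\ (Z j m w).2 @[m --> \oo] --> time j w,
    (Z j m w).1 @[m --> \oo] --> pos j w,
    pos j w = b (time j w) &
    [/\ 0 <= time j w <= j%:R,
      (time j w < j%:R -> ~~ (eps j < b (time j w) < 1 - eps j)),
      (forall t, 0 <= t < time j w -> eps j <= b t <= 1 - eps j) &
      0 <= b (time j w) <= 1]].
Proof.
move=> [Bw cw] b.
have ZE m : Z j m w = dyadic_walk b (eps j) (1 - eps j) j m.
  by rewrite /dyadic_walk /path_walk /b Bw.
have b01 : 0 <= b 0 <= 1 by rewrite /b Bw.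
have e1 : 1 - eps j <= 1 by rewrite lerBlDr lerDl ltW.
have [s [cvg_s cvg_b s_bnd s_stop [s_before s_pos]]] :=
  dyadic_walk_cvg cw j b01 (ltW (eps_gt0 j)) e1.
have limE (u : nat -> R) (l : R) : u @ \oo --> l ->
  fine (limn_esup (fun m => (u m)%:E)) = l.
  move=> ul; have ule : (u m)%:E @[m --> \oo] --> l%:E.
    by apply: cvg_EFin => //; exact: nearW.
  by rewrite (cvg_limn_einf_sup ule).2.
have timeE : time j w = s by rewrite /time; apply: limE;
  under eq_fun do rewrite ZE.
have posE : pos j w = b s by rewrite /pos; apply: limE;
  under eq_fun do rewrite ZE.
rewrite timeE posE; split => //; under eq_fun do rewrite ZE; by [].
Qed.

Let mlap t j : measurable_fun setT
  (fun w => expR (t * pos j w - t ^+ 2 / 2 * time j w)).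
Proof.
by apply: measurableT_comp => //; apply: measurable_funB;
  exact: measurable_funM.
Qed.

(** A Gaussian step can overshoot the window arbitrarily far, so the integrands are unbounded before
    the limit in [m]. Their squares are the exponentials for 2 t times exp (t^2 s) with s <= j,
    which yields the required L^2 bound. *)
Let exp_pos t j :
  (\int[P]_w (expR (t * pos j w - t ^+ 2 / 2 * time j w))%:E =
    (expR (t * p))%:E)%E.
Proof.
apply: (@square_bounded_cvg_integral _ _ _ P
  (fun m w => expR (t * (Z j m w).1 - t ^+ 2 / 2 * (Z j m w).2)) _ _ _ _ _
  (expR (t * p)) (expR (2 * t * p + t ^+ 2 * j%:R)) (expR `|t|)).
- move=> m; apply: measurableT_comp => //.
  by apply: measurable_funB; apply: measurable_funM => //;
    exact: measurableT_comp.
- exact: mlap.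
- apply: filterS ae_good => w /(goodP j)[cvg_time cvg_pos _ _].
  apply: continuous_cvg; first exact: continuous_expR.
  by apply: cvgB; apply: cvgM => //; exact: cvg_cst.
- by move=> m w; exact: expR_ge0.
- apply: filterS ae_good => w /(goodP j)[_ _ ->
  [/andP[time0 _] _ _ /andP[b0 b1]]].
  rewrite ler_expR; have h : 0 <= t ^+ 2 / 2 * time j w.
    by rewrite mulr_ge0// divr_ge0// sqr_ge0.
  have := ler_norm t; have := normr_ge0 t; move: (`|t|) => a a0 ta.
  move: (B _ w : R) b0 b1 => x x0 x1; nra.
- by move=> m; exact: expZ.
- move=> m;
  have E w : (expR (t * (Z j m w).1 - t ^+ 2 / 2 * (Z j m w).2) ^+ 2)%:E =
      (expR (2 * t * (Z j m w).1 - (2 * t) ^+ 2 / 2 * (Z j m w).2 +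
        t ^+ 2 * (Z j m w).2))%:E :> \bar R.
    by rewrite -expRM_natl; congr (expR _)%:E; field.
  under eq_integral do rewrite E.
  apply: (@le_trans _ _
    (\int[P]_w ((expR (t ^+ 2 * j%:R))%:E * (expR (2 * t * (Z j m w).1 -
     (2 * t) ^+ 2 / 2 * (Z j m w).2))%:E))%E).
    apply: ge0_le_integral => //.
    - apply/measurable_EFinP; apply: measurableT_comp => //;
      apply: measurable_funD.
        by apply: measurable_funB; apply: measurable_funM => //;
          exact: measurableT_comp.
      by apply: measurable_funM => //; exact: measurableT_comp.
    - apply: emeasurable_funM => //; apply/measurable_EFinP;
      apply: measurableT_comp => //.
      by apply: measurable_funB; apply: measurable_funM => //;
        exact: measurableT_comp.
    - move=> w _; rewrite lee_fin expRD mulrC ler_wpM2r ?expR_ge0// ler_expR.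
      rewrite ler_wpM2l ?sqr_ge0//.
      apply: le_trans (stopped_walk_time_le _ _ _ _ _ (ltW (step_gt0 m))) _.
      by rewrite natrM natrX mulfK// gt_eqF// exprn_gt0.
  rewrite ge0_integralZl//; last first.
    apply/measurable_EFinP; apply: measurableT_comp => //.
    by apply: measurable_funB; apply: measurable_funM => //;
      exact: measurableT_comp.
  by rewrite expZ -EFinM -expRD addrC.
Qed.

(** [tau] is built from upper limits and is therefore measurable on all of [T]; it agrees with the
    exit time on every path that starts at [p] and is continuous. *)
Lemma measurable_exit_time : exists tau : T -> \bar R,
  [/\ measurable_fun setT tau, forall w, (0 <= tau w)%E,
      {ae P, forall w, exit_time B w = tau w} &
      forall t, t != 0 -> (\int[P]_w (laplace t (tau w))%:E =
        (cosh (t * (p - 2^-1)) / cosh (t / 2))%:E)%E].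
Proof.
pose tau w := maxe (limn_esup (fun j => (time j w)%:E)) 0%E.
have mtau : measurable_fun setT tau.
  apply: measurable_maxe => //; apply: measurable_fun_limn_esup => j.
  exact/measurable_EFinP.
have tau0 w : (0 <= tau w)%E by rewrite le_max lexx orbT.
have eps_cvg0 : eps @ \oo --> 0.
  by rewrite -[eps]/(fun n => (@harmonic R) n.+1) cvg_shiftS;
    exact: cvg_harmonic.
have good_tau w : good w -> exit_time B w = tau w.
  move=> gw; have H j := goodP j gw.
  have cvg_time : (time j w)%:E @[j --> \oo] --> exit_time B w.
    apply: (@s_cvg_exit _ _ gw.2 eps) => // j; have [_ _ _ []//] := H j.
  rewrite /tau (cvg_limn_einf_sup cvg_time).2 max_l//.
  exact: (@path_exit_ge0 _ (fun t => B t w)).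
have cvg_X t w : t != 0 -> good w ->
   laplace t (time j w)%:E * cosh (t * (pos j w - 2^-1)) @[j --> \oo] -->
   laplace t (tau w) * cosh (t / 2).
  move=> t0 gw; have H j := goodP j gw; rewrite -good_tau//.
  have posE j : pos j w = B (time j w) w by have [_ _ ->] := H j.
  under eq_fun do rewrite posE.
  apply: (@laplace_cosh_cvg_exit _ _ gw.2 eps) => // j; have [_ _ _ []//] :=
    H j.
exists tau; split => //.
  by apply: filterS ae_good => w; exact: good_tau.
move=> t t0.
pose X j w := laplace t (time j w)%:E * cosh (t * (pos j w - 2^-1)).
(* cosh splits into two exponentials, the martingales for t and for - t, each of known mean by
   [exp_pos]. *)
have XE j w : X j w = expR (- (t / 2)) / 2 * expR (t * pos j w - t ^+ 2 / 2 *
  time j w) +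
    expR (t / 2) / 2 * expR (- t * pos j w - (- t) ^+ 2 / 2 * time j w).
  rewrite /X (_ : t * (pos j w - 2^-1) = t * pos j w + - (t / 2));
    last by field.
  by rewrite /cosh /= opprD opprK sqrrN mulNr !expRD; field.
have mX j : measurable_fun setT (X j).
  rewrite (_ : X j = (fun w => expR (- (t / 2)) / 2 *
      expR (t * pos j w - t ^+ 2 / 2 * time j w) + expR (t / 2) / 2 *
      expR (- t * pos j w - (- t) ^+ 2 / 2 * time j w))); last exact/funext/XE.
  by apply: measurable_funD; apply: measurable_funM => //; exact: mlap.
have intX j : (\int[P]_w (X j w)%:E = (cosh (t * (p - 2^-1)))%:E)%E.
  under eq_integral do rewrite XE EFinD.
  have mE t' c : measurable_fun setT
    (fun w => (c * expR (t' * pos j w - t' ^+ 2 / 2 * time j w))%:E).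
    by apply/measurable_EFinP; apply: measurable_funM => //; exact: mlap.
  rewrite (@ge0_integralD _ _ _ P _ measurableT _ _ _ (mE _ _) _ (mE _ _));
    last 2 first.
  - by move=> w _; rewrite lee_fin mulr_ge0 ?expR_ge0// divr_ge0 ?expR_ge0.
  - by move=> w _; rewrite lee_fin mulr_ge0 ?expR_ge0// divr_ge0 ?expR_ge0.
  under eq_integral do rewrite EFinM.
  under [X in (_ + X)%E]eq_integral do rewrite EFinM.
  rewrite !ge0_integralZl//; try by apply/measurable_EFinP; exact: mlap.
  rewrite !exp_pos -!EFinM -EFinD; congr EFin.
  rewrite /cosh mulrAC -expRD [X in _ + X]mulrAC -expRD -mulrDl.
  by congr ((expR _ + expR _) / 2); field.
have tauX : (\int[P]_w (laplace t (tau w) * cosh (t / 2))%:E =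
  (cosh (t * (p - 2^-1)))%:E)%E.
  have : (\int[P]_w (X j w)%:E)%E @[j --> \oo] -->
      (\int[P]_w (laplace t (tau w) * cosh (t / 2))%:E)%E.
    apply: (@bounded_cvg_integral _ _ _ _ _ _ (cosh (t / 2))) => //.
    - by apply: measurable_funM => //; exact: measurable_laplace.
    - by apply: filterS ae_good => w; exact: cvg_X.
    - apply: filterS ae_good => w gw i;
      have [_ _ posE [/andP[time0 _] _ _ b01]] := goodP i gw.
      rewrite ger0_norm;
        last by rewrite mulr_ge0 ?laplace_ge0 ?(ltW (cosh_gt0 _)).
      have l1 : laplace t (time i w)%:E <= 1 by apply: laplace_le1;
        rewrite lee_fin.
      have c1 : cosh (t * (pos i w - 2^-1)) <= cosh (t / 2).
        by apply: cosh_unit_interval; rewrite posE.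
      by rewrite /X -[leRHS]mul1r ler_pM ?laplace_ge0 ?(ltW (cosh_gt0 _)).
  under eq_fun do rewrite intX.
  by move=> /cvg_lim <-//; rewrite lim_cst.
have c0 := cosh_gt0 (t / 2).
under eq_integral => w _.
  rewrite (_ : laplace t (tau w) = (cosh (t / 2))^-1 *
    (laplace t (tau w) * cosh (t / 2))); last first.
    by rewrite mulrCA mulVf ?mulr1// gt_eqF.
  rewrite EFinM; over.
rewrite ge0_integralZl//.
- by rewrite tauX -EFinM mulrC.
- by apply/measurable_EFinP; apply: measurable_funM => //;
  exact: measurable_laplace.
- by move=> w _; rewrite lee_fin mulr_ge0 ?laplace_ge0 ?(ltW c0).
- by rewrite lee_fin invr_ge0 ltW.
Qed.

End brownian_exit.

(** * Dyadic martingales as step functions on [0, 1[ *)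

Section dyadic_steps.
Context {R : realType}.
Local Notation mu := (@lebesgue_measure R).
Implicit Types (n k : nat) (x : R) (c : nat -> R).

Definition dyadic_step n c x : R :=
  \sum_(k < 2 ^ n) c k * \1_(dyadic_interval n k) x.

Definition dyadic_index n x : nat := Num.truncn (x * 2 ^+ n).

Let pow2_gt0 n : 0 < 2 ^+ n :> R. Proof. by rewrite exprn_gt0. Qed.

Lemma dyadic_intervalP n k x : 0 <= x ->
  dyadic_interval n k x <-> dyadic_index n x = k.
Proof.
move=> x0; rewrite /dyadic_interval /= in_itv/= ler_pdivrMr// ltr_pdivlMr//.
rewrite /dyadic_index; split=> [/andP[h1 h2]|<-].
  by apply: truncn_def; rewrite h1.
by rewrite truncn_itv// mulr_ge0// ltW.
Qed.

Lemma dyadic_interval_ge0 n k x : dyadic_interval n k x -> 0 <= x.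
Proof.
rewrite /dyadic_interval /= in_itv/= => /andP[+ _]; apply: le_trans.
by rewrite divr_ge0// ltW.
Qed.

Lemma dyadic_interval_lt1 n k x : (k < 2 ^ n)%N -> dyadic_interval n k x ->
  x < 1.
Proof.
move=> kn; rewrite /dyadic_interval /= in_itv/= => /andP[_ xk].
by apply: lt_le_trans xk _; rewrite ler_pdivrMr// mul1r -natrX ler_nat.
Qed.

Lemma dyadic_index_lt n x : 0 <= x < 1 -> (dyadic_index n x < 2 ^ n)%N.
Proof.
move=> /andP[x0 x1]; rewrite /dyadic_index.
rewrite truncn_lt_nat ?mulr_ge0 ?exprn_ge0// natrX gtr_pMl//.
Qed.

Lemma dyadic_indexS n x : 0 <= x -> dyadic_index n x = (dyadic_index n.+1 x)./2.
Proof.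
move=> x0; apply/dyadic_intervalP => //; have :=
  (dyadic_intervalP n.+1 (dyadic_index n.+1 x) x0).2 erefl.
set k := dyadic_index _ _; rewrite /dyadic_interval/= !in_itv/=.
rewrite !ler_pdivrMr// !ltr_pdivlMr// exprS => /andP[h1 h2].
have E := odd_double_half k.
have h3 : (k./2.*2)%:R <= (k%:R : R) by rewrite ler_nat -[leqRHS]E leq_addl.
have h4 : (k.+1%:R : R) <= (k./2.+1.*2)%:R.
  by rewrite ler_nat -[k in k.+1]E doubleS ltnS; case: (odd k).
move: h3 h4; rewrite -!mul2n !natrM => h3 h4; apply/andP; split; lra.
Qed.

Lemma dyadic_step_in n c x : 0 <= x < 1 ->
  dyadic_step n c x = c (dyadic_index n x).
Proof.
move=> /andP[x0 x1]; have kn : (dyadic_index n x < 2 ^ n)%N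
  by rewrite dyadic_index_lt// x0.
rewrite /dyadic_step (bigD1 (Ordinal kn))//= big1 => [|i ik].
  by rewrite addr0 indicE mem_set ?mulr1//; exact/dyadic_intervalP.
rewrite indicE memNset ?mulr0// => /(dyadic_intervalP _ _ x0) E.
by move/eqP : ik; apply; apply/val_inj.
Qed.

Lemma dyadic_step_out n c x : ~~ (0 <= x < 1) -> dyadic_step n c x = 0.
Proof.
move=> x01; rewrite /dyadic_step big1// => i _.
rewrite indicE memNset ?mulr0// => ix; move/negP : x01; apply.
by rewrite (dyadic_interval_ge0 ix) (dyadic_interval_lt1 (ltn_ord i) ix).
Qed.

Lemma measurable_dyadic_interval n k : measurable (dyadic_interval n k : set R).
Proof. exact: measurable_itv. Qed.

Lemma measurable_dyadic_step n c : measurable_fun setT (dyadic_step n c).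
Proof.
apply: measurable_sum => k; apply: measurable_funM => //.
by apply: measurable_indic; exact: measurable_dyadic_interval.
Qed.

Lemma lebesgue_dyadic_interval n k :
  mu (dyadic_interval n k) = ((2 ^+ n)^-1)%:E.
Proof.
rewrite /dyadic_interval lebesgue_measure_itv/= lte_fin ltr_pM2r ?invr_gt0//.
by rewrite ltr_nat ltnS leqnn -EFinD -mulrBl -natrB// subSnn mul1r.
Qed.

Lemma integral_dyadic_step n c : (forall k, 0 <= c k) ->
  (\int[mu]_(x in `[0%R, 1%R[) (dyadic_step n c x)%:E = (dyadic_mean n c)%:E)%E.
Proof.
move=> c0; under eq_integral do rewrite /dyadic_step -sumEFin.
rewrite ge0_integral_sum//; last 2 first.
- move=> k; apply/measurable_EFinP/measurable_funTS;
  apply: measurable_funM => //.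
  by apply: measurable_indic; exact: measurable_dyadic_interval.
- by move=> k x _; rewrite lee_fin mulr_ge0.
rewrite /dyadic_mean big_mkord mulr_sumr -sumEFin; apply: eq_bigr => k _.
under eq_integral do rewrite EFinM.
rewrite ge0_integralZl ?lee_fin//; last first.
  apply/measurable_EFinP/measurable_funTS.
  by apply: measurable_indic; exact: measurable_dyadic_interval.
rewrite integral_indic//; last exact: measurable_dyadic_interval.
rewrite setIidl;
  first by rewrite -[LHS]/(_ * mu _)%E lebesgue_dyadic_interval -EFinM mulrC.
move=> x kx; rewrite /= in_itv/=.
by rewrite (dyadic_interval_ge0 kx) (dyadic_interval_lt1 (ltn_ord k) kx).
Qed.

Section array.
Variable v : nat -> nat -> R.

Definition square_sum_limit x : \bar R :=
  limn (fun n => (dyadic_step n (square_sum v n) x)%:E).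

Lemma square_sum_limit_cvg x :
  (dyadic_step n (square_sum v n) x)%:E @[n --> \oo] --> square_sum_limit x.
Proof.
apply: ereal_nondecreasing_is_cvgn; apply/nondecreasing_seqP => n;
  rewrite lee_fin.
have [x01|x01] := boolP (0 <= x < 1); last by rewrite !dyadic_step_out.
rewrite !dyadic_step_in//= -dyadic_indexS; last by case/andP : x01.
by rewrite lerDl sqr_ge0.
Qed.

Lemma square_sum_limit_ge0 x : (0 <= square_sum_limit x)%E.
Proof.
apply: lime_ge; first by apply/cvg_ex; eexists; exact: square_sum_limit_cvg.
apply: nearW => n; rewrite lee_fin /dyadic_step sumr_ge0// => k _.
by rewrite mulr_ge0// square_sum_ge0.
Qed.

Lemma square_sum_limit_out x : ~~ (0 <= x < 1) -> square_sum_limit x = 0%E.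
Proof.
move=> x01; rewrite /square_sum_limit; apply: lim_near_cst => //.
by apply: nearW => n; rewrite dyadic_step_out.
Qed.

Lemma measurable_square_sum_limit : measurable_fun setT square_sum_limit.
Proof.
apply: (emeasurable_fun_cvg (fun n x => (dyadic_step n (square_sum v n) x)%:E))
  => //.
- by move=> n; apply/measurable_EFinP; exact: measurable_dyadic_step.
- by move=> x _; exact: square_sum_limit_cvg.
Qed.

Lemma limn_einf_le (u : nat -> \bar R) (l : \bar R) :
  (\forall n \near \oo, u n <= l)%E -> (limn_einf u <= l)%E.
Proof.
move=> ul; rewrite limn_einf_lim; apply: lime_le; first exact: is_cvg_einfs.
apply: filterS ul => n; apply: le_trans.
by apply: ereal_inf_lbound; exists n => /=.
Qed.

Hypothesis mv : dyadic_martingale v.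
Hypothesis v01 : forall n k, 0 <= v n k <= 1.
Variable t : R.
Hypothesis t0 : t != 0.

Let e s : R := expR (- (t ^+ 2 / 2 * s)).

(** Fatou for the product of the Laplace factor with the cosine factor. The limits 0 and 1 lie at
    the same distance from 1/2, so the cosine factor tends to cosh (t / 2) in either case. *)
Lemma integral_laplace_square_sum_le :
  {ae mu, forall x, 0 <= x < 1 -> exists2 y : R, y = 0 \/ y = 1 &
     dyadic_step n (v n) x @[n --> \oo] --> y} ->
  (\int[mu]_(x in `[0%R, 1%R[) (laplace t (square_sum_limit x))%:E <=
   (cosh (t * (v 0 0 - 2^-1)) / cosh (t / 2))%:E)%E.
Proof.
move=> v_cvg.
pose c n k := e (square_sum v n k) * cosh (t * (v n k - 2^-1)).
have c0 n k : 0 <= c n k by rewrite mulr_ge0 ?expR_ge0 ?(ltW (cosh_gt0 _)).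
pose f n x : \bar R := (dyadic_step n (c n) x)%:E.
have fE x : 0 <= x < 1 ->
  f^~ x = (fun n => (laplace t (dyadic_step n (square_sum v n) x)%:E *
     cosh (t * (dyadic_step n (v n) x - 2^-1)))%:E).
  by move=> x01; apply/funext => n; rewrite /f !dyadic_step_in.
have mlap : measurable_fun setT (fun x => laplace t (square_sum_limit x)).
  by apply: measurable_laplace => //;
    [exact: measurable_square_sum_limit|exact: square_sum_limit_ge0].
have mf n : measurable_fun setT (f n).
  by apply/measurable_EFinP; exact: measurable_dyadic_step.
have ch0 := cosh_gt0 (t / 2).
rewrite mulrC EFinM lee_pdivlMl//.
rewrite -ge0_integralZl//; last 3 first.
- exact/measurable_EFinP/measurable_funTS.
- by move=> x _; rewrite lee_fin laplace_ge0.
- by rewrite lee_fin ltW.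
apply: (@le_trans _ _ (\int[mu]_(x in `[0%R, 1%R[) limn_einf (f ^~ x))%E).
  rewrite le_eqVlt; apply/orP; left; apply/eqP.
  apply: ae_eq_integral => //.
  - by apply: emeasurable_funM => //; exact/measurable_EFinP/measurable_funTS.
  - apply: measurable_funTS; rewrite /limn_einf; apply: measurableT_comp => //.
    apply: (@measurable_fun_limn_esup _ _ _ _ (fun n x => - f n x)%E) => n.
    by apply: measurableT_comp; [exact: oppe_measurable|exact: mf].
  apply: (@filterS _ _ (ae_filter_ringOfSetsType mu) _ _ _ v_cvg) => x vx.
  rewrite /= in_itv/= => x01.
  have [y y01 vy] := vx x01.
  have : f n x @[n --> \oo] -->
    (cosh (t / 2) * laplace t (square_sum_limit x))%:E.
    rewrite fE//; apply: cvg_EFin; first exact: nearW.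
    rewrite /comp/= [X in _ --> X]mulrC; apply: cvgM.
      exact: laplace_cvg t0 (square_sum_limit_ge0 x) (@square_sum_limit_cvg x).
    have -> : cosh (t / 2) = cosh (t * (y - 2^-1)).
      case: y01 => ->; last by congr cosh; field.
      by rewrite sub0r mulrN cosh_even.
    apply: continuous_cvg; first exact: continuous_cosh.
    by apply: cvgM; [exact: cvg_cst|apply: cvgB => //; exact: cvg_cst].
  by move=> /cvg_limn_einf_sup[-> _].
have mf' n : measurable_fun (`[0, 1[%classic : set R) (f n)
  by exact: measurable_funTS.
have f0 n x : (`[0, 1[%classic : set R) x -> (0 <= f n x)%E.
  by move=> _; rewrite lee_fin sumr_ge0// => k _; rewrite mulr_ge0.
apply: le_trans (fatou mu (measurable_itv _) mf' f0) _.
apply: limn_einf_le; apply: nearW => n.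
rewrite integral_dyadic_step// lee_fin; exact: dyadic_mean_laplace_le.
Qed.

(** Fatou bounds integrals of limits from above only; a lower bound on the transform is therefore
    obtained through its complement to 1, controlled at every level from [n] on. *)
Lemma integral_laplace_square_sum_ge h n :
  (forall i k, (i < n)%N -> `|v i.+1 k - v i k./2| <= h) ->
  (\int[mu]_(x in `[0%R, 1%R[) (1 - laplace t (square_sum_limit x))%:E <=
   (1 - cosh (t * (v 0 0 - 2^-1)) / cosh (t / 2) +
    ((t ^+ 2 / 2) ^+ 2 * h ^+ 2 +
     t ^+ 2 / 2 * dyadic_mean n (fun k => v n k * (1 - v n k))))%:E)%E.
Proof.
move=> vh.
pose c m k := 1 - e (square_sum v m k).
have c0 m k : 0 <= c m k.
  rewrite subr_ge0 -expR0 ler_expR oppr_le0 mulr_ge0 ?square_sum_ge0//.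
  by rewrite divr_ge0// sqr_ge0.
pose f m x : \bar R := (dyadic_step m (c m) x)%:E.
have mf m : measurable_fun setT (f m).
  by apply/measurable_EFinP; exact: measurable_dyadic_step.
apply: (@le_trans _ _ (\int[mu]_(x in `[0%R, 1%R[) limn_einf (f ^~ x))%E).
  rewrite le_eqVlt; apply/orP; left; apply/eqP; apply: eq_integral => x.
  rewrite inE/= in_itv/= => x01.
  have : f m x @[m --> \oo] --> (1 - laplace t (square_sum_limit x))%:E.
    apply: cvg_EFin; first exact: nearW.
    rewrite (_ : fine \o _ = fun m => 1 - laplace t
      (dyadic_step m (square_sum v m) x)%:E).
      apply: cvgB; first exact: cvg_cst.
      exact: laplace_cvg t0 (square_sum_limit_ge0 x) (@square_sum_limit_cvg x).
    by apply/funext => m; rewrite /f /= !dyadic_step_in.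
  by move=> /cvg_limn_einf_sup[-> _].
have mf' m : measurable_fun (`[0, 1[%classic : set R) (f m)
  by exact: measurable_funTS.
have f0 m x : (`[0, 1[%classic : set R) x -> (0 <= f m x)%E.
  by move=> _; rewrite lee_fin sumr_ge0// => k _; rewrite mulr_ge0.
apply: le_trans (fatou mu (measurable_itv _) mf' f0) _.
apply: limn_einf_le; near=> m.
rewrite integral_dyadic_step// lee_fin; apply: dyadic_mean_laplace_upper => //.
by near: m; exists n.
Unshelve. all: by end_near. Qed.

End array.
End dyadic_steps.

(** * The dyadic martingale of a Borel set *)

Section set_averages.
Context {R : realType}.
Local Notation mu := (@lebesgue_measure R).
Implicit Types (A : set R) (n k : nat) (x : R).

Definition set_average A n k : R :=
  interval_average (\1_A : R -> R) (dyadic_interval n k).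

Lemma dyadic_interval_split n k : dyadic_interval n k =
  dyadic_interval n.+1 k.*2 `|` dyadic_interval n.+1 k.*2.+1 :> set R.
Proof.
have pow0 m : 0 < 2 ^+ m :> R by rewrite exprn_gt0.
have e1 : (k.*2)%:R = k%:R * 2 :> R by rewrite -muln2 natrM.
have e2 : (k.*2.+1)%:R = k%:R * 2 + 1 :> R by rewrite -natr1 e1.
have e3 : (k.*2.+2)%:R = k%:R * 2 + 1 + 1 :> R by rewrite -natr1 e2.
have e4 : (k.+1)%:R = k%:R + 1 :> R by rewrite natr1.
apply/seteqP; split => x;
  rewrite /dyadic_interval/= !in_itv/= !ler_pdivrMr// !ltr_pdivlMr// exprS e1 e2
    e3 e4.
  move=> /andP[h1 h2]; have [h|h] := ltP (x * (2 * 2 ^+ n)) (k%:R * 2 + 1);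
    [left|right].
    by apply/andP; split; lra.
  by apply/andP; split; lra.
by move=> [] /andP[h1 h2]; apply/andP; split; lra.
Qed.

Lemma dyadic_interval_disj n k k' : (k <> k')%N ->
  dyadic_interval n k `&` dyadic_interval n k' = set0 :> set R.
Proof.
move=> kk'; apply/seteqP; split => // x [kx k'x]; apply: kk'.
have x0 := dyadic_interval_ge0 kx.
by move: kx k'x => /(dyadic_intervalP _ _ x0) <- /(dyadic_intervalP _ _ x0) <-.
Qed.

Section measurable_set.
Variable A : set R.
Hypothesis mA : measurable A.

Let mI n k : measurable (A `&` dyadic_interval n k : set R).
Proof. by apply: measurableI => //; exact: measurable_dyadic_interval. Qed.

Lemma measure_setI_dyadic_interval n k :
  (mu (A `&` dyadic_interval n k) <= ((2 ^+ n)^-1)%:E)%E.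
Proof.
rewrite -(lebesgue_dyadic_interval n k); apply: le_measure.
- by rewrite inE; exact: mI.
- by rewrite inE; exact: measurable_dyadic_interval.
- exact: subIsetr.
Qed.

Lemma measure_setI_dyadic_interval_fin n k :
  mu (A `&` dyadic_interval n k) \is a fin_num.
Proof.
rewrite ge0_fin_numE ?measure_ge0//.
by apply: le_lt_trans (measure_setI_dyadic_interval n k) _; rewrite ltry.
Qed.

Lemma set_averageE n k :
  set_average A n k = 2 ^+ n * fine (mu (A `&` dyadic_interval n k)).
Proof.
rewrite /set_average /interval_average lebesgue_dyadic_interval/= invrK.
by rewrite /Rintegral integral_indic//; exact: measurable_dyadic_interval.
Qed.

Lemma dyadic_martingale_set_average : dyadic_martingale (set_average A).
Proof.
move=> n k; rewrite !set_averageE dyadic_interval_split setIUr.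
have disj : A `&` dyadic_interval n.+1 k.*2 `&` (A `&` dyadic_interval n.+1
  k.*2.+1) = set0.
  by rewrite setIACA dyadic_interval_disj ?setI0.
have -> : (mu (A `&` dyadic_interval n.+1 k.*2 `|` A `&` dyadic_interval n.+1
  k.*2.+1) =
    mu (A `&` dyadic_interval n.+1 k.*2) +
      mu (A `&` dyadic_interval n.+1 k.*2.+1))%E.
  by apply: measureU => //; exact: mI.
rewrite fineD ?measure_setI_dyadic_interval_fin// exprS.
by field.
Qed.

Lemma set_average_ge0_le1 n k : 0 <= set_average A n k <= 1.
Proof.
rewrite set_averageE mulr_ge0 ?exprn_ge0 ?fine_ge0//=.
rewrite -ler_pdivlMl ?exprn_gt0// mulr1 -lee_fin fineK
  ?measure_setI_dyadic_interval_fin//.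
exact: measure_setI_dyadic_interval.
Qed.

Lemma set_average00 : A `<=` `[0, 1[ -> (set_average A 0 0)%:E = mu A.
Proof.
move=> A01;
  rewrite set_averageE expr0 mul1r fineK ?measure_setI_dyadic_interval_fin//.
congr (mu _); apply: setIidl; apply: subset_trans A01 _ => x.
by rewrite /dyadic_interval/= expr0 !divr1.
Qed.

Lemma square_function_indic x : 0 <= x < 1 ->
  square_function (\1_A : R ->
    R) x = sqrte (square_sum_limit (set_average A) x).
Proof.
(* The series starts at 1, so its partial sum over indices below [n.+1] is the square sum of level
   [n]; hence the shift. *)
move=> x01; congr sqrte; apply/cvg_lim => //; rewrite -cvg_shiftS.
have E n : (\sum_(1 <= i < n.+1) (`|martingale_difference (\1_A : R ->
  R) i x| ^+ 2)%:E =
    (dyadic_step n (square_sum (set_average A) n) x)%:E)%E.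
  have x0 : 0 <= x by case/andP : x01.
  elim: n => [|n IH]; first by rewrite big_geq// dyadic_step_in.
  rewrite big_nat_recr//= IH -EFinD !dyadic_step_in//=.
  congr EFin; rewrite -dyadic_indexS//; congr (_ + _).
  rewrite real_normK ?num_real// /martingale_difference/=.
  rewrite -[dyadic_condexp _ n.+1 x]/(dyadic_step n.+1 (set_average A n.+1) x).
  rewrite -[dyadic_condexp _ n x]/(dyadic_step n (set_average A n) x).
  by rewrite !dyadic_step_in.
under eq_fun do rewrite E.
exact: square_sum_limit_cvg.
Qed.

(** The square sum vanishes outside [0, 1[, as does the kernel at time 0; this allows passing to the
    whole line, where Tonelli applies, and back. *)
Lemma levy_const_norm1 :
  (levy_const * norm1 (square_function (\1_A : R -> R)) =
   \int[mu]_t \int[mu]_(x in `[0%R, 1%R[)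
     levy_kernel t (square_sum_limit (set_average A) x))%E.
Proof.
set s := square_sum_limit (set_average A).
have -> : (norm1 (square_function (\1_A : R -> R)) = \int[mu]_x sqrte (s x))%E.
  rewrite /norm1 integral_mkcond; apply: eq_integral => x _.
  rewrite /patch; case: ifPn => [|]; rewrite ?notin_setE ?inE/= in_itv/= => x01.
    by rewrite square_function_indic// gee0_abs// sqrte_ge0.
  by rewrite /s square_sum_limit_out ?sqrte0//; exact/negP.
rewrite levy_const_integral_sqrte//; last 2 first.
- exact: measurable_square_sum_limit.
- exact: square_sum_limit_ge0.
apply: eq_integral => t _; rewrite [RHS]integral_mkcond;
  apply: eq_integral => x _.
rewrite /patch; case: ifPn => [|];
  rewrite ?notin_setE ?inE/= in_itv/= => x01 //.
by rewrite /s square_sum_limit_out ?levy_kernel0//; exact/negP.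
Qed.

(** Lebesgue differentiation along the dyadic intervals containing [x], which shrink nicely although
    [x] is not their centre. *)
Lemma dyadic_differentiation : (mu A < +oo)%E -> {ae mu, forall x, 0 <= x < 1 ->
  exists2 y : R, y = 0 \/ y = 1 &
  dyadic_step n (set_average A n) x @[n --> \oo] --> y}.
Proof.
(* A shrinking family is required at every real [x]; outside [0, 1[ the intervals [[x, x + 2^-n[]
   serve. *)
move=> Aoo; pose left_end x n : R :=
  if 0 <= x < 1 then (dyadic_index n x)%:R / 2 ^+ n else x.
pose E x n : set R := `[left_end x n, left_end x n + (2 ^+ n)^-1[%classic.
have pow0 m : 0 < (2 ^+ m)^-1 :> R by rewrite invr_gt0 exprn_gt0.
have Ex x n : left_end x n <= x < left_end x n + (2 ^+ n)^-1.
  rewrite /left_end; case: ifPn => [/andP[x0 x1]|_];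
    last by rewrite lexx ltrDl pow0.
  have := (dyadic_intervalP n (dyadic_index n x) x0).2 erefl.
  by rewrite /dyadic_interval/= in_itv/= -(@natr1 _ (dyadic_index n x)) mulrDl
    mul1r.
have muE x n : mu (E x n) = ((2 ^+ n)^-1)%:E.
  by rewrite lebesgue_measure_itv/= lte_fin ltrDl pow0 -EFinD addrAC subrr
    add0r.
have hE x : nicely_shrinking x (E x).
  split; first by move=> n; exact: measurable_itv.
  have r0 n : 0 < 2 * (2 ^+ n)^-1 :> R by rewrite mulr_gt0.
  (* The ball of radius 2 * 2^-n contains the interval and has 4 times its measure. *)
  exists (4, fun n => PosNum (r0 n)) => /=; split => //.
  - rewrite -[X in _ --> X](mulr0 2); apply: cvgM; first exact: cvg_cst.
    under eq_fun do rewrite -exprVn.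
    by apply: cvg_expr; rewrite ger0_norm ?invr_ge0//; lra.
  - move=> n y; rewrite /E /= in_itv/= /ball/= => /andP[h1 h2].
    have /andP[h3 h4] := Ex x n; have := pow0 n.
    by rewrite ltr_norml => ?; apply/andP; split; lra.
  - move=> n; rewrite lebesgue_measure_ball//= muE -EFinM lee_fin.
    by rewrite -mulr_natr; lra.
have li : locally_integrable setT (\1_A : R -> R).
  apply: open_integrable_locally; first exact: openT.
  apply/integrableP; split;
    first by apply/measurable_EFinP; exact: measurable_indic.
  under eq_integral => x _ do rewrite /= ger0_norm//.
  by rewrite integral_indic// setIT.
apply: (@filterS _ _ (ae_filter_ringOfSetsType mu) _ _ _
  (lebesgue_differentiation li)) => x lx x01.
exists (\1_A x); first by rewrite indicE; case: (x \in A); [right|left].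
have := nice_lebesgue_differentiation hE li lx.
move=> /fine_cvg; apply: cvg_trans; apply: near_eq_cvg; apply: nearW => n /=.
have EI : E x n = dyadic_interval n (dyadic_index n x).
  by rewrite /E /left_end x01 /dyadic_interval -(@natr1 _ (dyadic_index n x))
    mulrDl mul1r.
rewrite dyadic_step_in// set_averageE EI lebesgue_dyadic_interval inver.
rewrite gt_eqF// invrK integral_indic//; last exact: measurable_dyadic_interval.
by rewrite fineM ?measure_setI_dyadic_interval_fin.
Qed.

End measurable_set.
End set_averages.

(** * Sets driven by a walk with small steps *)

Section small_step_walk.
Context {R : realType}.
Local Notation mu := (@lebesgue_measure R).
Variables (p h : R).
Hypotheses (p01 : 0 <= p <= 1) (h0 : 0 < h) (h1 : h <= 1).

Definition walk_step (y : R) : R := Num.min h (Num.min y (1 - y)).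

Fixpoint walk_array n k : R :=
  if n is m.+1 then
    let y := walk_array m k./2 in
    if odd k then y + walk_step y else y - walk_step y
  else p.

Lemma walk_step_ge0 y : 0 <= y <= 1 -> 0 <= walk_step y.
Proof. by move=> y01; rewrite !le_min (ltW h0); lra. Qed.

Lemma walk_array01 n k : 0 <= walk_array n k <= 1.
Proof.
elim: n k => // n IH k; rewrite [walk_array _ _]/=; have := IH k./2.
move: (walk_array n _) => y y01.
have a0 := walk_step_ge0 y01.
have ay : walk_step y <= y by rewrite /walk_step !ge_min lexx orbT.
have ay1 : walk_step y <= 1 - y by rewrite /walk_step !ge_min lexx !orbT.
by case: ifP => _; lra.
Qed.

Lemma dyadic_martingale_walk : dyadic_martingale walk_array.
Proof.
by move=> n k /=; rewrite odd_double uphalf_double doubleK /=; field.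
Qed.

Lemma walk_array_jump n k :
  `|walk_array n.+1 k - walk_array n k./2| = walk_step (walk_array n k./2).
Proof.
have a0 := walk_step_ge0 (walk_array01 n k./2).
rewrite /=; case: ifP => _; rewrite addrAC subrr add0r ?normrN ger0_norm//.
Qed.

Lemma walk_step_le y : walk_step y <= h.
Proof. by rewrite ge_min lexx. Qed.

(** A lower bound by a multiple of y (1 - y), the quantity whose mean has to be made small. *)
Lemma walk_step_ge y : 0 <= y <= 1 -> h * (y * (1 - y)) <= walk_step y.
Proof.
move=> y01; rewrite !le_min; have y1 : 0 <= y * (1 - y) by apply: mulr_ge0; lra.
have y2 : y * (1 - y) <= 1 by nra.
have hy : h * (y * (1 - y)) <= y * (1 - y) by rewrite ler_piMl.
apply/andP; split; first by rewrite ler_piMr// ltW.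
by apply/andP; split; apply: le_trans hy _; nra.
Qed.

(* Each step where the mean of [v (1 - v)] exceeds [q] increases the mean of
   [v ^ 2] by at least [(h q) ^ 2], which can happen only finitely often. *)
Lemma walk_array_absorbed (q : R) : 0 < q ->
  exists n, dyadic_mean n (fun k => walk_array n k * (1 - walk_array n k)) <= q.
Proof.
move=> q0; apply/not_existsP => H.
have {}H n : q < dyadic_mean n (fun k => walk_array n k * (1 - walk_array n k)).
  by rewrite ltNge; apply/negP; exact: H.
have mv := dyadic_martingale_walk.
have inc n : n%:R * (h * q) ^+ 2 <= dyadic_mean n (square_sum walk_array n).
  elim: n => [|n IH].
    by rewrite mul0r dyadic_mean0.
  rewrite dyadic_mean_square_sumS// -natr1 mulrDl mul1r lerD//.
  (* The tangent inequality z^2 >= 2 q z - q^2 replaces Jensen: it is linear in z = y (1 - y), so it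
     averages to at least q^2 when the mean of z exceeds [q]. *)
  have key k :
      h ^+ 2 * (2 * q * (walk_array n k * (1 - walk_array n k)) - q ^+ 2) <=
      (walk_array n.+1 k.*2.+1 - walk_array n k) ^+ 2.
    have := walk_array_jump n k.*2.+1; rewrite /= uphalf_double => E.
    rewrite -[leRHS]real_normK ?num_real// E.
    have := walk_step_ge (walk_array01 n k); have := walk_array01 n k.
    move: (walk_array n k) => y y01 ay.
    have y1 : 0 <= y * (1 - y) by apply: mulr_ge0; lra.
    apply: (@le_trans _ _ ((h * (y * (1 - y))) ^+ 2)).
      by rewrite exprMn ler_wpM2l ?sqr_ge0//; have := sqr_ge0 (y * (1 - y) - q);
        lra.
    have hy : 0 <= h * (y * (1 - y)) by rewrite mulr_ge0// ltW.
    by rewrite ler_sqr ?nnegrE// walk_step_ge0.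
  apply: le_trans (le_dyadic_mean n key).
  rewrite dyadic_meanZ dyadic_meanB dyadic_meanZ dyadic_mean_cst exprMn.
  rewrite ler_wpM2l ?sqr_ge0//; have := H n; nra.
have hq : 0 < (h * q) ^+ 2 by rewrite exprn_gt0// mulr_gt0.
have [n] : exists n : nat, 1 / (h * q) ^+ 2 < n%:R.
  by exists (Num.truncn (1 / (h * q) ^+ 2)).+1; rewrite truncnS_gt.
rewrite ltr_pdivrMr// => lt1; have := inc n.
have := dyadic_mean_square_sum_le mv walk_array01 n; lra.
Qed.

Section filled_set.
Variable n : nat.

(* Stopping the walk at level [n]: on each dyadic interval of that level the set
   is the initial segment with the density prescribed by the walk. *)
Definition filled_set : set R :=
  \bigcup_(k in `I_(2 ^ n)) `[k%:R / 2 ^+ n,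
    (k%:R + walk_array n k) / 2 ^+ n[%classic.

Lemma measurable_filled_set : measurable filled_set.
Proof. by apply: bigcup_measurable => k _; exact: measurable_itv. Qed.

Let sub_interval k :
  `[k%:R / 2 ^+ n, (k%:R + walk_array n k) / 2 ^+ n[%classic
    `<=` (dyadic_interval n k : set R).
Proof.
move=> x; rewrite /dyadic_interval /= !in_itv/= => /andP[-> xk] /=.
apply: lt_le_trans xk _; rewrite ler_pM2r ?invr_gt0 ?exprn_gt0//.
by rewrite -natr1 lerD2l; have /andP[] := walk_array01 n k.
Qed.

Lemma filled_set01 : filled_set `<=` `[0, 1[.
Proof.
move=> x [k /= kn /sub_interval xk]; rewrite /= in_itv/=.
by rewrite (dyadic_interval_ge0 xk) (dyadic_interval_lt1 kn xk).
Qed.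

Lemma filled_set_average_top k : (k < 2 ^ n)%N ->
  set_average filled_set n k = walk_array n k.
Proof.
move=> kn; rewrite set_averageE; last exact: measurable_filled_set.
have -> : filled_set `&` dyadic_interval n k =
    `[k%:R / 2 ^+ n, (k%:R + walk_array n k) / 2 ^+ n[%classic.
  apply/seteqP; split => [x [[k' /= k'n xk'] xk]|x xk]; last first.
    by split; [exists k|exact: sub_interval].
  have [<-//|/eqP kk'] := eqVneq k' k.
  have : (dyadic_interval n k' `&` dyadic_interval n k) x.
    by split => //; exact: sub_interval.
  by rewrite dyadic_interval_disj.
have pow0 : 0 < 2 ^+ n :> R by rewrite exprn_gt0.
rewrite lebesgue_measure_itv/= lte_fin ltr_pM2r ?invr_gt0// ltrDl.
have /andP[v0 _] := walk_array01 n k.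
move: v0; rewrite le_eqVlt => /predU1P[<-|->]; first by rewrite ltxx /= mulr0.
by rewrite -EFinD -mulrBl addrAC subrr add0r /= mulrC divfK// gt_eqF.
Qed.

(** Downward induction from level [n]: both arrays are martingales and agree there. *)
Lemma filled_set_average m k : (m <= n)%N -> (k < 2 ^ m)%N ->
  set_average filled_set m k = walk_array m k.
Proof.
move=> mn; rewrite -(subKn mn); move: (n - m)%N (leq_subr m n) => i.
elim: i k => [|i IH] k i_n;
  first by rewrite subn0; exact: filled_set_average_top.
have E : (n - i = (n - i.+1).+1)%N by rewrite subnSK.
move=> kn.
have kn0 : (k.*2 < 2 ^ (n - i))%N by rewrite E expnS mul2n ltn_double.
have kn1 : (k.*2.+1 < 2 ^ (n - i))%N by rewrite E expnS mul2n ltn_Sdouble.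
rewrite dyadic_martingale_walk dyadic_martingale_set_average;
  last exact: measurable_filled_set.
by rewrite -E !IH// ltnW.
Qed.

Lemma filled_set_jump i k : (i < n)%N ->
  `|set_average filled_set i.+1 k - set_average filled_set i k./2| <= h.
Proof.
move=> i_n.
have [kn|kn] := ltnP k (2 ^ i.+1).
  have kn2 : (k./2 < 2 ^ i)%N by rewrite ltn_half_double -mul2n -expnS.
  rewrite !filled_set_average// ?(ltnW i_n)// walk_array_jump.
  exact: walk_step_le.
(* The bound is wanted for every [k]; an interval beyond [0, 1[ misses the set, although
   [walk_array] need not vanish at its index. *)
have out j l : (2 ^ j <= l)%N -> set_average filled_set j l = 0.
  move=> jl; rewrite set_averageE; last exact: measurable_filled_set.
  rewrite (_ : _ `&` _ = set0) ?measure0 ?mulr0//.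
  apply/seteqP; split => // x [/filled_set01 + xl].
  rewrite /= in_itv/= => /andP[_]; rewrite ltNge => /negP; apply.
  move: xl; rewrite /dyadic_interval/= in_itv/= => /andP[+ _]; apply: le_trans.
  by rewrite ler_pdivlMr ?exprn_gt0// mul1r -natrX ler_nat.
rewrite !out ?subrr ?normr0 ?ltW//.
by rewrite geq_half_double -mul2n -expnS.
Qed.

Lemma borel_filled_set : borel_subset_of_measure p filled_set.
Proof.
split; [exact: measurable_filled_set|exact: filled_set01|].
rewrite -set_average00; last exact: filled_set01.
  by rewrite filled_set_average// expn0.
exact: measurable_filled_set.
Qed.

Lemma filled_set_rest :
  dyadic_mean n (fun k => set_average filled_set n k *
    (1 - set_average filled_set n k)) =
  dyadic_mean n (fun k => walk_array n k * (1 - walk_array n k)).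
Proof.
by congr (_ * _); apply: eq_big_nat => k /andP[_ kn];
  rewrite filled_set_average_top.
Qed.

End filled_set.
End small_step_walk.

(** * Comparison of the two sides *)

Section comparison.
Context {R : realType}.
Local Notation mu := (@lebesgue_measure R).
Implicit Types (t p h : R) (s : \bar R).

(** With u = t^2 h, the exponent at time 2 h is exactly - u, and 1 - exp (- u) >= u / (1 + u) >= min
    (1, u) / 2. *)
Lemma levy_kernel_small t h : 0 <= h ->
  Num.min 1 (t ^+ 2 * h) <= 2 * (1 - laplace t (2 * h)%:E).
Proof.
move=> h0; rewrite /laplace (_ : t ^+ 2 / 2 * (2 * h) = t ^+ 2 * h);
  last by field.
have u0 : 0 <= t ^+ 2 * h by rewrite mulr_ge0 ?sqr_ge0.
move: (t ^+ 2 * h) u0 => u u0.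
have := expR_ge1Dx u; have e0 := expR_gt0 (- u); have := expRxMexpNx_1 u.
move: (expR u) (expR (- u)) e0 => a b b0 ab ua.
have bu : b * (1 + u) <= 1 by nra.
by have [u1|u1] := leP 1 u; nra.
Qed.

Section measure_space.
Context d (X : measurableType d) (m : {measure set X -> \bar R}) (D : set X).
Hypotheses (mD : measurable D) (mD1 : m D = 1%E).
Variable s : X -> \bar R.
Hypotheses (ms : measurable_fun setT s) (s0 : forall x, (0 <= s x)%E).

Let mL t : measurable_fun setT (fun x => laplace t (s x)).
Proof. exact: measurable_laplace. Qed.

Lemma integral_laplace_compl t :
  (\int[m]_(x in D) (1 - laplace t (s x))%:E + \int[m]_(x in D)
    (laplace t (s x))%:E = 1)%E.
Proof.
rewrite -ge0_integralD//; last 4 first.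
- by move=> x _; rewrite lee_fin subr_ge0 laplace_le1.
- apply/measurable_EFinP/measurable_funTS; apply: measurable_funB => //.
- by move=> x _; rewrite lee_fin laplace_ge0.
- exact/measurable_EFinP/measurable_funTS.
under eq_integral do rewrite -EFinD subrK.
by rewrite integral_cst// mul1e.
Qed.

Lemma integral_levy_kernel_scale t :
  (\int[m]_(x in D) levy_kernel t (s x) =
   (t ^- 2)%:E * \int[m]_(x in D) (1 - laplace t (s x))%:E)%E.
Proof.
rewrite -ge0_integralZl//;
  first by apply: eq_integral => x _; rewrite -EFinM mulrC.
- by apply/measurable_EFinP/measurable_funTS; apply: measurable_funB.
- by move=> x _; rewrite lee_fin subr_ge0 laplace_le1.
- by rewrite lee_fin invr_ge0 sqr_ge0.
Qed.

End measure_space.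
Section ae_equal.
Import HBNNSimple.
Context d (X : measurableType d) (m : {measure set X -> \bar R}).

Lemma ge0_le_integral_nonmeasurable (f g : X -> \bar R) :
  (forall x, 0 <= f x <= g x)%E -> (\int[m]_x f x <= \int[m]_x g x)%E.
Proof.
move=> fg; have f0 x : (0 <= f x)%E by have /andP[] := fg x.
have g0 x : (0 <= g x)%E by have /andP[/le_trans +] := fg x; apply.
rewrite !ge0_integralTE//; apply: ereal_sup_le => _ [k /= kf <-].
by exists k => //= x; apply: le_trans (kf x) _; have /andP[] := fg x.
Qed.

(* [f] need not be measurable: its integral is the supremum of the
   integrals of the simple functions below it. *)
Lemma ae_eq_integral_nonmeasurable (f g : X -> \bar R) :
  measurable_fun setT g -> (forall x, 0 <= f x)%E -> (forall x, 0 <= g x)%E ->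
  {ae m, forall x, f x = g x} -> (\int[m]_x f x = \int[m]_x g x)%E.
Proof.
move=> mg f0 g0 [N [mN N0 fgN]].
have fg x : ~ N x -> f x = g x by move=> /(contra_not (fgN x))/contrapT.
have off (k : X -> \bar R) : measurable_fun setT k -> (forall x, 0 <= k x)%E ->
    [/\ measurable_fun setT (k \_ (~` N)), forall x, (0 <= (k \_ (~` N)) x)%E &
      (\int[m]_x k x = \int[m]_x (k \_ (~` N)) x)%E].
  move=> mk k0; have mk' : measurable_fun setT (k \_ (~` N)).
    by apply/(measurable_restrictT _ _).1;
      [exact: measurableC|exact: measurable_funTS].
  have k'0 x : (0 <= (k \_ (~` N)) x)%E by rewrite /patch; case: ifP.
  split => //; apply: ge0_ae_eq_integral => //.
  exists N; split => // x /= kx; apply: contrapT => Nx; apply: kx => _.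
  by rewrite /patch mem_set; last exact: Nx.
(* With [N] the exceptional null set, [g] cut to 0 on [N] lies below [f] everywhere; conversely a
   simple function below [f], cut in the same way, lies below [g]. *)
apply/eqP; rewrite eq_le; apply/andP; split; last first.
  have [_ g'0 ->] := off g mg g0; apply: ge0_le_integral_nonmeasurable => x.
  rewrite g'0 /patch; case: ifPn => [|_]; last exact: f0.
  by rewrite inE => Nx; rewrite (fg _ Nx) lexx.
rewrite [leLHS]ge0_integralTE//; apply: ge_ereal_sup => _ [k /= kf <-].
rewrite -integralT_nnsfun.
have mk : measurable_fun setT (fun x : X => (k x)%:E) by exact/measurable_EFinP.
have k0 (x : X) : (0 <= (k x)%:E)%E by rewrite lee_fin.
have [mk' k'0 ->] := off _ mk k0; apply: ge0_le_integral => // x _.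
rewrite /patch; case: ifPn => [|_]; last exact: g0.
by rewrite inE => Nx; rewrite -(fg _ Nx); exact: kf.
Qed.

End ae_equal.
End comparison.

Section bounds.
Context {R : realType} d (T : measurableType d) (P : probability T R).
Local Notation mu := (@lebesgue_measure R).
Variables (p : R) (tau : T -> \bar R).
Hypotheses (p01 : 0 <= p <= 1) (mtau : measurable_fun setT tau).
Hypotheses (tau0 : forall w, (0 <= tau w)%E).
Hypothesis tau_laplace : forall t, t != 0 ->
  (\int[P]_w (laplace t (tau w))%:E =
    (cosh (t * (p - 2^-1)) / cosh (t / 2))%:E)%E.

Let phi t := cosh (t * (p - 2^-1)) / cosh (t / 2).

Let D : set R := `[0, 1[%classic.
Let mD : measurable D. Proof. exact: measurable_itv. Qed.
Let muD : mu D = 1%E.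
Proof. by rewrite /D lebesgue_measure_itv/= lte_fin ltr01 -EFinD subr0. Qed.

Lemma integral_laplace_compl_eq d' (X : measurableType d')
  (m : {measure set X -> \bar R})
    (E : set X) (s : X -> \bar R) t c : measurable E -> m E = 1%E ->
  measurable_fun setT s -> (forall x, (0 <= s x)%E) ->
  (\int[m]_(x in E) (laplace t (s x))%:E = c%:E)%E ->
  (\int[m]_(x in E) (1 - laplace t (s x))%:E = (1 - c)%:E)%E.
Proof.
move=> mE mE1 ms s0 sc; have := integral_laplace_compl mE mE1 ms s0 t.
rewrite sc EFinB => <-; rewrite addeK//.
Qed.

Let kernel_tau t : (\int[P]_w levy_kernel t (tau w) = (t ^- 2)%:E *
  (1 - phi t)%:E)%E.
Proof.
rewrite (integral_levy_kernel_scale P measurableT mtau tau0).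
have [->|t0] := eqVneq t 0; first by rewrite expr0n/= invr0 !mul0e.
congr (_ * _)%E; apply: integral_laplace_compl_eq => //.
- exact: probability_setT.
- exact: tau_laplace.
Qed.

(** Extending [s] by 0 outside [E] turns the integral into one over [X], because the kernel vanishes
    at time 0; measurability then comes from Tonelli. *)
Let mkernel d' (X : measurableType d') (m : {sigma_finite_measure set X ->
  \bar R})
    (E : set X) (s : X -> \bar R) : measurable E ->
  measurable_fun setT s -> (forall x, (0 <= s x)%E) ->
  measurable_fun setT (fun t : R => \int[m]_(x in E) levy_kernel t (s x))%E.
Proof.
move=> mE ms s0.
pose s' := s \_ E.
have ms' : measurable_fun setT s' by apply/(measurable_restrictT _ _).1 => //;
  exact: measurable_funTS.
have s'0 x : (0 <= s' x)%E by rewrite /s' /patch; case: ifP.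
have -> : (fun t : R => \int[m]_(x in E) levy_kernel t (s x))%E =
    fubini_F m (fun z : R * X => levy_kernel z.1 (s' z.2)).
  apply/funext => t; rewrite /fubini_F [LHS]integral_mkcond /=.
  apply: eq_integral => x _.
  by rewrite /s' /patch; case: ifP => //; rewrite levy_kernel0.
apply: measurable_fun_fubini_tonelli_F.
- by apply: measurable_levy_kernel => //; exact: measurableT_comp.
- by move=> z; exact: levy_kernel_ge0.
Qed.

Let phi_le1 t : phi t <= 1.
Proof.
rewrite /phi ler_pdivrMr ?cosh_gt0// mul1r.
by apply: cosh_unit_interval.
Qed.

(** [levy_const] is positive and finite, so it can be multiplied in; the kernels are then compared
    for each [t]. *)
Lemma norm1_square_function_ge (A : set R) : borel_subset_of_measure p A ->
  (\int[P]_w sqrte (tau w) <= norm1 (square_function (\1_A : R -> R)))%E.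
Proof.
move=> [mA A01 Ap].
have K0 := @levy_const_gt0 R; have Kfin : levy_const \is a @fin_num R.
  by rewrite ge0_fin_numE ?levy_const_lty// ltW.
rewrite -(lee_pmul2l Kfin K0) levy_const_norm1 (levy_const_integral_sqrte P mtau
  tau0).
pose s := square_sum_limit (set_average A).
have ms : measurable_fun setT s by exact: measurable_square_sum_limit.
have s0 x : (0 <= s x)%E by exact: square_sum_limit_ge0.
have v00 : set_average A 0 0 = p.
  by apply: EFin_inj; rewrite set_average00.
apply: ge0_le_integral => //.
- by move=> t _; apply: integral_ge0 => w _; exact: levy_kernel_ge0.
- exact: mkernel.
- exact: mkernel.
move=> t _; rewrite kernel_tau (integral_levy_kernel_scale mu mD ms s0).
have [->|t0] := eqVneq t 0; first by rewrite expr0n/= invr0 !mul0e.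
rewrite lee_wpmul2l ?lee_fin ?invr_ge0 ?sqr_ge0//.
have Aoo : (mu A < +oo)%E by rewrite Ap ltry.
have := integral_laplace_square_sum_le (dyadic_martingale_set_average mA) t0
  (dyadic_differentiation mA Aoo).
rewrite v00 -/(phi t) => Lphi.
have := @integral_laplace_compl _ _ _ mu D mD muD s ms s0 t.
have L0 : (0 <= \int[mu]_(x in D) (laplace t (s x))%:E)%E.
  by apply: integral_ge0 => x _; rewrite lee_fin laplace_ge0.
have Lfin : (\int[mu]_(x in D) (laplace t (s x))%:E)%E \is a fin_num.
  by rewrite ge0_fin_numE//; apply: le_lt_trans Lphi _; rewrite ltry.
move=> E1; rewrite EFinB leeBlDr// -E1 leeD2l//.
Qed.

Lemma norm1_square_function_le (h : R) : 0 < h -> h <= 1 -> exists2 A : set R,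
  borel_subset_of_measure p A &
  (norm1 (square_function (\1_A : R -> R)) <=
   \int[P]_w sqrte (tau w) + (2 * Num.sqrt (2 * h))%:E)%E.
Proof.
move=> h0 h1.
(* The residual mean is made at most [h], matching the bound on the jumps. *)
have [n nq] := walk_array_absorbed p01 h0 h1 h0.
have bA := borel_filled_set p01 h0 n.
exists (filled_set p h n) => //; have [mA A01 Ap] := bA.
set A := filled_set p h n in bA mA A01 Ap *.
have K0 := @levy_const_gt0 R; have Kfin : levy_const \is a @fin_num R.
  by rewrite ge0_fin_numE ?levy_const_lty// ltW.
have h2 : (0 <= (2 * h)%:E)%E by rewrite lee_fin mulr_ge0// ltW.
rewrite -(lee_pmul2l Kfin K0) levy_const_norm1.
rewrite ge0_muleDr; last 2 first.
- by apply: integral_ge0 => w _; exact: sqrte_ge0.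
- by rewrite lee_fin mulr_ge0 ?sqrtr_ge0.
rewrite (levy_const_integral_sqrte P mtau tau0) EFinM muleCA.
rewrite -[X in (2%:E * X)%E](@integral_levy_kernel R (2 * h)%:E h2).
pose s := square_sum_limit (set_average A).
have ms : measurable_fun setT s by exact: measurable_square_sum_limit.
have s0 x : (0 <= s x)%E by exact: square_sum_limit_ge0.
have v00 : set_average A 0 0 = p.
  by apply: EFin_inj; rewrite set_average00.
have mk2 : measurable_fun setT (fun t : R => levy_kernel t (2 * h)%:E).
  by apply: measurable_levy_kernel.
have mkt : measurable_fun setT (fun t : R => \int[P]_w levy_kernel t (tau w))%E
  by exact: mkernel.
rewrite -ge0_integralZl//; last first.
  by move=> t _; exact: levy_kernel_ge0.
rewrite -ge0_integralD//; last 3 first.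
- by move=> t _; apply: integral_ge0 => w _; exact: levy_kernel_ge0.
- by move=> t _; rewrite mule_ge0// levy_kernel_ge0.
- exact: emeasurable_funM.
apply: ge0_le_integral => //.
- by move=> t _; apply: integral_ge0 => w _; exact: levy_kernel_ge0.
- exact: mkernel.
- by apply: emeasurable_funD => //; exact: emeasurable_funM.
move=> t _; rewrite kernel_tau (integral_levy_kernel_scale mu mD ms s0).
rewrite /levy_kernel -!EFinM mulrA [2 * _ / _]mulrC -EFinD -mulrDr EFinM.
have [->|t0] := eqVneq t 0; first by rewrite expr0n/= invr0 !mul0e.
rewrite lee_wpmul2l ?lee_fin ?invr_ge0 ?sqr_ge0//.
have small := levy_kernel_small t (ltW h0).
apply: (@le_trans _ _ (1 - phi t + Num.min 1 (t ^+ 2 * h))%:E); last first.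
  by rewrite lee_fin lerD2l.
have phi1 := phi_le1 t.
have u0 : 0 <= t ^+ 2 * h by rewrite mulr_ge0 ?sqr_ge0// ltW.
(* For t^2 h >= 1 the polynomial error is useless, but the left side is at most 1 anyway. Otherwise,
   with u = t^2 h, the error u^2 / 4 + u / 2 is at most u. *)
have [u1|u1] := leP 1 (t ^+ 2 * h).
  apply: (@le_trans _ _ 1%E); last by rewrite lee_fin; lra.
  rewrite -(@integral_laplace_compl _ _ _ mu D mD muD s ms s0 t) leeDl//.
  by apply: integral_ge0 => x _; rewrite lee_fin laplace_ge0.
apply: le_trans (integral_laplace_square_sum_ge (dyadic_martingale_set_average
  mA)
  (set_average_ge0_le1 mA) t0 (filled_set_jump p01 h0 (n := n))) _.
rewrite v00 -/(phi t) lee_fin lerD2l filled_set_rest//.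
apply: (@le_trans _ _ ((t ^+ 2 / 2) ^+ 2 * h ^+ 2 + t ^+ 2 / 2 * h)).
  by rewrite lerD2l ler_wpM2l// divr_ge0 ?sqr_ge0.
rewrite [leLHS](_ : _ = (t ^+ 2 * h) ^+ 2 / 4 + t ^+ 2 * h / 2); last by field.
by have := ltW u1; move: (t ^+ 2 * h) u0 => u u0 u1'; nra.
Qed.

End bounds.

Theorem theorem1p1 (R : realType) (p : R) (hp0 : 0 <= p) (hp1 : p <= 1)
    (d : measure_display) (T : measurableType d) (P : probability T R)
    (B : R -> {RV P >-> R}) (hB : brownian_motion p B) :
  ereal_inf [set norm1 (square_function (\1_A : R -> R)) |
              A in [set A : set R | borel_subset_of_measure p A]] =
  (\int[P]_w sqrte (exit_time B w))%E.
Proof.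
have p01 : 0 <= p <= 1 by rewrite hp0.
have [tau [mtau tau0 tauE tauL]] := measurable_exit_time p01 hB.
have exit0 w : (0 <= sqrte (exit_time B w))%E by exact: sqrte_ge0.
have stau0 w : (0 <= sqrte (tau w))%E by exact: sqrte_ge0.
rewrite (ae_eq_integral_nonmeasurable (measurable_sqrte mtau tau0) exit0 stau0); last first.
  by apply: filterS tauE => w ->.
apply/eqP; rewrite eq_le; apply/andP; split; last first.
  apply: le_ereal_inf_tmp => _ [A /= bA <-].
  exact: norm1_square_function_ge mtau tau0 tauL _ bA.
apply/lee_addgt0Pr => e e0.
(* Chosen so that sqrt (2 h) <= e / 2. *)
pose h := Num.min 1 ((e / 2) ^+ 2 / 2).
have h0 : 0 < h by rewrite lt_min ltr01 divr_gt0// exprn_gt0// divr_gt0.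
have h1 : h <= 1 by rewrite ge_min lexx.
have [A bA le_A] := norm1_square_function_le p01 mtau tau0 tauL h0 h1.
apply: (@le_trans _ _ (norm1 (square_function (\1_A : R -> R)))).
  by apply: ereal_inf_lbound; exists A.
apply: le_trans le_A _; rewrite leeD2l// lee_fin mulrC -ler_pdivlMr//.
rewrite -[leRHS]ger0_norm ?divr_ge0 ?(ltW e0)// -sqrtr_sqr ler_sqrt ?sqr_ge0//.
by rewrite mulrC -ler_pdivlMr// ge_min lexx orbT.
Qed.
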